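(* Let $k,t \geq 2$ be coprime integers. Then the following hold: (1) If $1 \leq r \leq t - k$, then $r \succ_{k,t} r+k$. (2) If $1 \leq r \leq y \leq t$ and $r < s \leq t$, then for $k \geq y(y+1)$, $r \succ_{k,t} s$. In particular (case $y=1$), $1 \succ_{k,t} s$ for all $2\le s\le t$. (3) If $k \geq \frac{6(t^2-1)}{\pi^2}$, then for all $1 \leq r < s \leq t$ we have $r \succ_{k,t} s$. (4) If $k = mt - 1$ for some integer $m \geq 1$ and $k \leq \left(\frac{\pi^2}{6} + \frac{5}{2t}\right)^{-1}(t^2 - 1)$, then $t \succ_{k,t} t - 1$. (5) If $t > 2$, then $\mathscr{O}(t) \geq \frac{\varphi(t)}{2}$, where $\varphi$ is Euler's totient function.
   Context: A partition of $n$ is $k$-indivisible if none of its parts is divisible by $k$. $D_k^\times(r,t;n)$ denotes the total number of parts congruent to $r$ modulo $t$, counted with multiplicity over all $k$-indivisible partitions of $n$. For $1 \le r,s\le t$, write $r \succ_{k,t} s$ (resp. $r\prec_{k,t} s$) if $D_k^\times(r,t;n) > D_k^\times(s,t;n)$ (resp. $<$) for all sufficiently large $n$. $\mathscr{O}(t)$ denotes the number of distinct orderings of $\{1,\dots,t\}$ induced by $\prec_{k,t}$ as $k$ ranges over all integers $k\ge 2$ with $\gcd(k,t)=1$. *)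

(* Defs.v *)
From mathcomp Require Import all_boot.
From Stdlib Require Import Reals.

Set Implicit Arguments.
Unset Strict Implicit.
Unset Printing Implicit Defensive.

(* A partition of n is encoded by its multiplicity function:
   f i = number of parts equal to i.+1 (for i < n), with
   \sum_i (i.+1) * f i = n.  Multiplicities are at most n, so
   f : {ffun 'I_n -> 'I_n.+1}.  This is a bijection with partitions of n. *)
Definition is_partition (n : nat) (f : {ffun 'I_n -> 'I_n.+1}) : bool :=
  \sum_(i < n) i.+1 * f i == n.

Definition k_indivisible (k n : nat) (f : {ffun 'I_n -> 'I_n.+1}) : bool :=
  [forall i : 'I_n, (k %| i.+1) ==> (nat_of_ord (f i) == 0)].

Definition Dx (k r t n : nat) : nat :=
  \sum_(f : {ffun 'I_n -> 'I_n.+1} | is_partition f && k_indivisible k f)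
     \sum_(i < n | i.+1 == r %[mod t]) f i.

Definition succ_kt (k t r s : nat) : Prop :=
  exists N, forall n, N <= n -> Dx k s t n < Dx k r t n.

Definition prec_kt (k t r s : nat) : Prop :=
  exists N, forall n, N <= n -> Dx k r t n < Dx k s t n.

Definition same_ordering (t k1 k2 : nat) : Prop :=
  forall r s, 1 <= r <= t -> 1 <= s <= t -> (prec_kt k1 t r s <-> prec_kt k2 t r s).

(* Main.v *)
(** Write [p n] for the number of [k]-indivisible partitions of [n] and [delta n] for the
    number of those without the part 1, so that [p n - p (n - 1) = delta n].  Counting parts
    by multiplicity gives [D(r, t; n) = sum_x A_r(x) delta(n - x)] with
    [A_r(x) = sum_{d <= x, k does not divide d, d = r (mod t)} floor (x / d)].  Removing one
    large part, or many copies of a small one, shows that [p n] is eventually smaller than any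
    multiple of [sum_x x delta(n - x)]; hence [r] beats [s] as soon as [A_r(x) - A_s(x)] grows
    at least linearly in [x].  As the sums over residue classes interlace, this holds when
    [sum_j (1/(r+jt) - 1/(s+jt)) > (1/k) sum_j (1/(r'+jt) - 1/(s'+jt))], where
    [k r' = r] and [k s' = s (mod t)] with [1 <= r', s' <= t].  Parts (1)-(4) are estimates
    of these two series, the last two through [zeta(2) = PI^2/6].  For (5), if
    [1 < i < j < t/2] then [j] beats [i + j] for the modulus [k = i] by (1), and loses to it
    for [k = j], because there the part [j] itself is forbidden. *)

Require Import Defs.
From mathcomp Require Import all_boot zify_ssreflect.
From Stdlib Require Import Reals Lra Lia.
Import ssrnat.

Set Implicit Arguments.
Unset Strict Implicit.
Unset Printing Implicit Defensive.

(** * Counting partitions and parts *)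

(** The bound [N] on part sizes is kept apart from the weight [m]: deleting parts then changes [m]
    but not the type of [f]. *)
Definition parts (A : pred nat) (N m : nat) : {set {ffun 'I_N -> 'I_N.+1}} :=
  [set f : {ffun 'I_N -> 'I_N.+1} | (\sum_(i < N) i.+1 * f i == m)
           && [forall i : 'I_N, ~~ A i.+1 ==> (f i == 0 :> nat)]].

Definition npart (A : pred nat) (m : nat) : nat := #|parts A m m|.

Implicit Types A : pred nat.

Lemma partsP A N m (f : {ffun 'I_N -> 'I_N.+1}) :
  reflect (\sum_(i < N) i.+1 * f i = m /\
           forall i : 'I_N, ~~ A i.+1 -> f i = 0 :> nat) (f \in parts A N m).
Proof.
rewrite inE; apply: (iffP andP) => [[/eqP h1 /forallP h2]|[h1 h2]]; split=> //.
- by move=> i Ai; apply/eqP; move: (h2 i); rewrite Ai.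
- exact/eqP.
- by apply/forallP => i; apply/implyP => Ai; apply/eqP/h2.
Qed.

Lemma parts_term A N m (f : {ffun 'I_N -> 'I_N.+1}) (i : 'I_N) :
  f \in parts A N m -> i.+1 * f i <= m.
Proof. by case/partsP => <- _; rewrite (bigD1 i) //= leq_addr. Qed.

Definition mult N (f : {ffun 'I_N -> 'I_N.+1}) (j : nat) : nat :=
  if insub j is Some i then f i else 0.

Lemma multE N (f : {ffun 'I_N -> 'I_N.+1}) (i : 'I_N) : mult f i = f i.
Proof. by rewrite /mult valK. Qed.

Lemma mult_parts A N m (f : {ffun 'I_N -> 'I_N.+1}) j :
  f \in parts A N m -> j.+1 * mult f j <= m.
Proof.
rewrite /mult; case: insubP => [i _ <-|_ _]; last by rewrite muln0.
exact: parts_term.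
Qed.

Lemma sum_mult N M m (f : {ffun 'I_N -> 'I_N.+1}) :
  m <= N -> m <= M -> (forall j, m <= j -> mult f j = 0) ->
  \sum_(i < M) i.+1 * mult f i = \sum_(i < N) i.+1 * f i.
Proof.
move=> mN mM f0; under [RHS]eq_bigr do rewrite -multE.
have E K : m <= K ->
  \sum_(i < K) i.+1 * mult f i = \sum_(i < m) i.+1 * mult f i.
  move=> mK; rewrite (big_ord_widen K (fun i => i.+1 * mult f i) mK).
  rewrite [LHS](bigID (fun i : 'I_K => i < m)) /= [X in _ + X]big1 ?addn0 //.
  by move=> i; rewrite -leqNgt => /f0 ->; rewrite muln0.
by rewrite !E.
Qed.

(** A partition of [m] has neither a part nor a multiplicity above [m], so cutting or extending the
    range of its multiplicity function to [M >= m] is injective. *)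
Lemma leq_card_parts A N M m : m <= N -> m <= M -> #|parts A N m| <= #|parts A M m|.
Proof.
move=> mN mM.
pose G (f : {ffun 'I_N -> 'I_N.+1}) : {ffun 'I_M -> 'I_M.+1} :=
  [ffun i : 'I_M => inord (mult f i)].
have f0 f : f \in parts A N m -> forall j, m <= j -> mult f j = 0.
  by move=> fP j mj; have := mult_parts j fP; nia.
have Gv f i : f \in parts A N m -> G f i = mult f i :> nat.
  by move=> fP; rewrite ffunE inordK //; have := mult_parts i fP; nia.
have injG : {in parts A N m &, injective G}.
  move=> f g fP gP eG; apply/ffunP => i; apply/val_inj => /=.
  rewrite -!multE; case: (ltnP i m) => im; last by rewrite !f0.
  have := congr1 (fun h : {ffun 'I_M -> 'I_M.+1} =>
                    h (Ordinal (leq_trans im mM)) : nat) eG.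
  by rewrite /= !Gv.
rewrite -(card_in_imset injG); apply: subset_leq_card; apply/subsetP => h.
case/imsetP => f fP ->; case/partsP: (fP) => fm fA; apply/partsP; split.
  by under eq_bigr do rewrite Gv //; rewrite (sum_mult mN mM) //; apply: f0.
move=> i Ai; rewrite Gv // /mult; case: insubP => // j _ ji.
by apply: fA; rewrite ji.
Qed.

Lemma card_parts A N m : m <= N -> #|parts A N m| = npart A m.
Proof. by move=> mN; apply/eqP; rewrite eqn_leq !leq_card_parts. Qed.

(** Adding [j] copies of the part [i.+1] is a bijection from the partitions of [m - j * i.+1]. The
    test matters: for [j * i.+1 > m] truncated subtraction would count the empty partition. *)
Lemma card_parts_ge A N m (i : 'I_N) j : m <= N -> A i.+1 ->
  #|[set f in parts A N m | j <= f i]| =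
  if j * i.+1 <= m then npart A (m - j * i.+1) else 0.
Proof.
move=> mN Ai; case: ifP => [jm|/negbT jm]; last first.
  apply/eqP; rewrite cards_eq0; apply/eqP/setP => f; rewrite !inE.
  apply/negbTE/negP => /andP [fP jf]; move: (@parts_term A N m f i).
  rewrite inE fP => /(_ isT) /(leq_trans _) h; case/negP: jm; apply: h.
  by rewrite mulnC leq_mul2l jf.
rewrite -(@card_parts A N); last by lia.
pose up (f : {ffun 'I_N -> 'I_N.+1}) : {ffun 'I_N -> 'I_N.+1} :=
  [ffun l => if l == i then inord (f l + j) else f l].
have upi f : f \in parts A N (m - j * i.+1) -> up f i = f i + j :> nat.
  move=> fP; rewrite ffunE eqxx inordK // ltnS; have h := parts_term i fP.
  apply: leq_trans mN; apply: leq_trans (leq_pmulr _ (ltn0Sn i)) _.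
  by rewrite mulnDl; lia.
have upl f l : l != i -> up f l = f l by rewrite ffunE => /negbTE ->.
have sum_up (f g : {ffun 'I_N -> 'I_N.+1}) : g i = f i + j :> nat -> (forall l, l != i -> g l = f l) ->
  \sum_(l < N) l.+1 * g l = j * i.+1 + \sum_(l < N) l.+1 * f l.
  move=> gi gl; rewrite (bigD1 i) //= [in RHS](bigD1 i) //= gi.
  rewrite (eq_bigr (fun l : 'I_N => l.+1 * f l)) => [|l li]; last by rewrite gl.
  by rewrite mulnDr addnA; congr (_ + _); lia.
have injG : {in parts A N (m - j * i.+1) &, injective up}.
  move=> f g fP gP eG; apply/ffunP => l; apply/val_inj => /=.
  have [->|li] := eqVneq l i; last by rewrite -(upl f) // eG upl.
  by have := upi _ fP; rewrite eG upi // => /addIn ->.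
rewrite -(card_in_imset injG); apply: eq_card => g; apply/idP/imsetP.
- rewrite inE => /andP [gP jg].
  pose f : {ffun 'I_N -> 'I_N.+1} :=
    [ffun l => if l == i then inord (g l - j) else g l].
  have fi : f i = g i - j :> nat.
    by rewrite ffunE eqxx inordK //; have := ltn_ord (g i); lia.
  have fl l : l != i -> f l = g l by rewrite ffunE => /negbTE ->.
  have fP : f \in parts A N (m - j * i.+1).
    case/partsP: gP => gm gA; apply/partsP; split.
      have := @sum_up f g; rewrite fi subnK // => /(_ erefl) E.
      by rewrite -gm E ?addKn // => l /fl ->.
    by move=> l; have [->|/fl -> /gA] := eqVneq l i; rewrite ?Ai.
  exists f => //; apply/ffunP => l; apply/val_inj => /=.
  have [->|li] := eqVneq l i; last by rewrite upl // fl.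
  by rewrite upi // fi subnK.
- case=> f fP ->; rewrite inE upi // leq_addl andbT.
  case/partsP: (fP) => fm fA; apply/partsP; split.
    by rewrite (sum_up f) ?upi //; last exact: upl; rewrite fm subnKC.
  by move=> l Al; rewrite upl ?fA //; apply: contraNneq Al => ->.
Qed.

(** * Splitting off the part 1 *)

Definition no1 A : pred nat := fun d => A d && (d != 1).

(** Deleting one part 1 maps the partitions containing it bijectively onto those of [n]; the others
    avoid 1. *)
Lemma npartS A n : A 1 -> npart A n.+1 = npart A n + npart (no1 A) n.+1.
Proof.
move=> A1; rewrite [LHS]/npart.
rewrite -(cardsID [set f : {ffun 'I_n.+1 -> 'I_n.+2} | 0 < f ord0]).
congr (_ + _).
  rewrite -[RHS](_ : (if 1 * 1 <= n.+1 then npart A (n.+1 - 1 * 1) else 0) = _).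
    rewrite -(@card_parts_ge A n.+1 n.+1 ord0 1) //.
    by apply: eq_card => f; rewrite !inE.
  by rewrite mul1n subn1.
apply: eq_card => f; rewrite !inE andbCA; congr (_ && _).
apply/andP/forallP => [[f0 /forallP fA] i|fA].
  rewrite /no1 negb_and negbK; apply/implyP => /orP [/(implyP (fA i)) //|].
  rewrite eqSS => i0; rewrite (_ : i = ord0); last exact/val_inj/eqP.
  by move: f0; rewrite -leqNgt leqn0.
split; first by have := fA ord0; rewrite /no1 A1 /= -leqNgt leqn0.
apply/forallP => i; apply/implyP => Ai; apply: (implyP (fA i)).
by rewrite /no1 negb_and Ai.
Qed.

Lemma npart0 A : npart A 0 = 1.
Proof.
rewrite -(cards1 ([ffun => ord0] : {ffun 'I_0 -> 'I_1})).
apply: eq_card => f; rewrite !inE big_ord0 eqxx /=.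
have -> : f = [ffun => ord0] by apply/ffunP => -[].
by rewrite eqxx; apply/forallP => -[].
Qed.

Lemma npart_sum A n : A 1 -> npart A n = \sum_(x < n.+1) npart (no1 A) (n - x).
Proof.
move=> A1; elim: n => [|n IH]; first by rewrite big_ord1 !npart0.
rewrite npartS // big_ord_recl subn0 addnC IH; congr (_ + _).
Qed.

Lemma npart_gt0 A n : A 1 -> 0 < npart A n.
Proof. by move=> A1; elim: n => [|n IH]; rewrite ?npart0 // npartS // addn_gt0 IH. Qed.

(** * Counting parts through divisor sums *)

Lemma card_le_sum (c m : nat) : c <= m -> c = \sum_(j < m) (j < c).
Proof.
move=> cm; rewrite -[LHS]card_ord -sum1_card.
rewrite (big_ord_widen m (fun=> 1) cm) big_mkcond /=.
by apply: eq_bigr => j _; case: ifP.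
Qed.

Lemma divn_sum (d x n : nat) : 0 < d -> x <= n -> x %/ d = \sum_(j < n) (j.+1 * d <= x).
Proof.
move=> d0 xn; rewrite [LHS](@card_le_sum _ n); last by exact: leq_trans (leq_div _ _) xn.
by apply: eq_bigr => j _; rewrite leq_divRL.
Qed.

(** A multiplicity is the number of [j] below it; after exchanging sums, the partitions with at
    least [j.+1] copies of [i.+1] are counted by [card_parts_ge]. *)
Lemma Dx_count k r t n : Defs.Dx k r t n =
  \sum_(i < n | ~~ (k %| i.+1) && (i.+1 == r %[mod t]))
    \sum_(j < n) (if j.+1 * i.+1 <= n
                  then npart (fun d => ~~ (k %| d)) (n - j.+1 * i.+1) else 0).
Proof.
set A := fun d => ~~ (k %| d).
have -> : Defs.Dx k r t n = \sum_(f in parts A n n)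
    \sum_(i < n | ~~ (k %| i.+1) && (i.+1 == r %[mod t])) f i.
  apply: eq_big => f.
    rewrite inE /is_partition /k_indivisible; congr (_ && _).
    by apply: eq_forallb => i; rewrite /A negbK.
  case/andP => _ /forallP fk; rewrite [LHS](bigID (fun i : 'I_n => k %| i.+1)) /=.
  rewrite big1 ?add0n; last by move=> i /andP [_ ki]; move: (fk i); rewrite ki => /eqP.
  by apply: eq_bigl => i; rewrite andbC.
rewrite exchange_big /=; apply: eq_bigr => i /andP [ki _].
transitivity (\sum_(f in parts A n n) \sum_(j < n) (j < f i)).
  by apply: eq_bigr => f _; apply: card_le_sum; rewrite -ltnS.
rewrite exchange_big /=; apply: eq_bigr => j _.
rewrite -(@card_parts_ge A n n i j.+1) // -sum1_card.
rewrite (eq_bigl (fun f => (f \in parts A n n) && (j < f i))) => [|f].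
  by rewrite big_mkcondr; apply: eq_bigr => f _; case: ifP.
by rewrite !inE.
Qed.

Definition Afun (k t r x : nat) : nat :=
  \sum_(i < x | ~~ (k %| i.+1) && (i.+1 == r %[mod t])) x %/ i.+1.

Lemma Afun_widen k t r x n : x <= n ->
  \sum_(i < n | ~~ (k %| i.+1) && (i.+1 == r %[mod t])) x %/ i.+1 = Afun k t r x.
Proof.
move=> xn; rewrite /Afun.
rewrite [RHS](big_ord_widen_cond n
  (fun i => ~~ (k %| i.+1) && (i.+1 == r %[mod t])) (fun i => x %/ i.+1) xn).
rewrite [LHS](bigID (fun i : 'I_n => i < x)) /= [X in _ + X]big1 ?addn0 //.
by move=> i /andP [_ xi]; rewrite divn_small // ltnS leqNgt.
Qed.

(** By [npart_sum], the count at [n - j * d] is a sum over all [x >= j * d]; the number of [j >= 1]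
    with [j * d <= x] is [x %/ d]. *)
Lemma Dx_Afun k r t n : 2 <= k -> Defs.Dx k r t n =
  \sum_(x < n.+1) Afun k t r x * npart (no1 (fun d => ~~ (k %| d))) (n - x).
Proof.
move=> k2; set A := fun d => ~~ (k %| d).
have A1 : A 1 by rewrite /A dvdn1; lia.
have pE y : y <= n -> npart A (n - y) =
    \sum_(x < n.+1) (y <= x) * npart (no1 A) (n - x).
  move=> yn; rewrite npart_sum // (reindex_inj rev_ord_inj) /=.
  rewrite [RHS](reindex_inj rev_ord_inj) /=.
  have nyn : (n - y).+1 <= n.+1 by rewrite ltnS leq_subr.
  under eq_bigr => i _ do rewrite subSS subKn -1?ltnS //.
  under [RHS]eq_bigr => i _ do rewrite subSS subKn -1?ltnS //.
  rewrite (big_ord_widen _ (npart (no1 A)) nyn) big_mkcond /=.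
  apply: eq_bigr => i _. rewrite (_ : (y < (n - i).+1) = (i < (n - y).+1)); last by have := ltn_ord i; lia.
  by case: ifP => _; rewrite ?mul1n ?mul0n.
rewrite Dx_count -/A.
transitivity (\sum_(i < n | ~~ (k %| i.+1) && (i.+1 == r %[mod t]))
    \sum_(j < n) \sum_(x < n.+1) (j.+1 * i.+1 <= x) * npart (no1 A) (n - x)).
- apply: eq_bigr => i _; apply: eq_bigr => j _.
  case: ifP => [/pE //|/negbT jn]; rewrite big1 // => x _.
  by rewrite (_ : (_ <= x) = false) ?mul0n //; have := ltn_ord x; lia.
under eq_bigr => i _ do rewrite exchange_big /=.
rewrite exchange_big /=; apply: eq_bigr => x _.
have xn : x <= n by rewrite -ltnS.
rewrite -(Afun_widen k t r xn) big_distrl /=; apply: eq_bigr => i _.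
by rewrite (@divn_sum _ x n) // big_distrl.
Qed.

(** * Subexponential growth *)

Lemma sum_ord_lt n D (c : nat) : D <= n -> \sum_(i < n | i < D) c = D * c.
Proof. by move=> Dn; rewrite -(big_ord_widen n (fun=> c) Dn) sum_nat_const card_ord. Qed.

(** Taken at [no1 A], this is what a gain of [x] in [Afun] contributes to the sum in [Dx_Afun]. *)
Definition Tsum A n := \sum_(x < n.+1) x * npart A (n - x).

Lemma leq_Tsum A n x : x <= n -> x * npart A (n - x) <= Tsum A n.
Proof.
rewrite -ltnS => xn; rewrite /Tsum (bigD1 (Ordinal xn)) //=; exact: leq_addr.
Qed.

(* A partition of a large [n] has either a part [>= D] or a part [< D] of
   multiplicity at least [D^2]; removing it loses at least [D]. *)
Lemma npart_remove A n D : 0 < D -> D ^ 4 < n -> npart A n <=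
  \sum_(i < n | D <= i.+1) npart A (n - 1 * i.+1) +
  \sum_(i < n | i < D)
     (if D ^ 2 * i.+1 <= n then npart A (n - D ^ 2 * i.+1) else 0).
Proof.
move=> D0 Dn.
have D_le_n : D <= n by apply: leq_trans (ltnW Dn); rewrite -{1}(expn1 D) leq_pexp2l.
have cnt (i : 'I_n) j : 0 < j -> \sum_(f in parts A n n) (j <= f i) <=
    if j * i.+1 <= n then npart A (n - j * i.+1) else 0.
  move=> j0; case Ai: (A i.+1).
    rewrite -(@card_parts_ge A n n i j) // -sum1_card.
    rewrite [X in _ <= X](eq_bigl (fun f => (f \in parts A n n) && (j <= f i))) => [|f].
      by rewrite [X in _ <= X]big_mkcondr; apply: leq_sum => f _; case: ifP.
    by rewrite !inE.
  rewrite big1 // => f /partsP [_ fA]; rewrite fA ?Ai //.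
  by case: j j0.
apply: (@leq_trans (\sum_(f in parts A n n)
  (\sum_(i < n | D <= i.+1) (1 <= f i) + \sum_(i < n | i < D) (D ^ 2 <= f i)))).
  rewrite /npart -sum1_card; apply: leq_sum => f /partsP [fn fA].
  rewrite lt0n addn_eq0 negb_and -!lt0n; apply/orP.
  case: (boolP [exists i : 'I_n, (D <= i.+1) && (1 <= f i)]) => [/existsP [i /andP [Di fi]]|].
    by left; rewrite (bigD1 i) //= fi.
  rewrite negb_exists => /forallP small; right.
  case: (boolP [exists i : 'I_n, (i < D) && (D ^ 2 <= f i)]) => [/existsP [i /andP [Di fi]]|].
    by rewrite (bigD1 i) //= fi.
  (* With neither kind of part, only indices below [D] occur: at most [D] parts, each of size at
     most [D] and multiplicity below [D ^ 2], hence weight at most [D ^ 4 < n]. *)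
  rewrite negb_exists => /forallP few; case/negP: (ltnn n).
  apply: leq_trans (Dn); rewrite ltnS -{1}fn (bigID (fun i : 'I_n => i < D)) /=.
  rewrite [X in _ + X]big1 ?addn0 => [|i]; last first.
    rewrite -leqNgt => Di; move: (small i); rewrite (leq_trans Di) //= -eqn0Ngt.
    by move=> /eqP ->; rewrite muln0.
  rewrite (_ : D ^ 4 = D * (D * D ^ 2)); last by rewrite -!expnS.
  rewrite -(sum_ord_lt (D * D ^ 2) D_le_n); apply: leq_sum => i iD.
  by move: (few i); rewrite iD /= -ltnNge => /ltnW; apply: leq_mul.
rewrite big_split /= exchange_big [X in _ + X]exchange_big /=.
apply: leq_add; apply: leq_sum => i _; last by apply: cnt; rewrite expn_gt0 D0.
by apply: leq_trans (cnt i 1 isT) _; rewrite mul1n ltn_ord.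
Qed.

(** Removing a part of size at least [D] earns a weight of at least [D] in [Tsum]. Each of the [D]
    terms of the second kind earns [D ^ 2], so together they cost only one more [Tsum]. *)
Lemma npart_le_Tsum A n D : 0 < D -> D ^ 4 < n -> D * npart A n <= 2 * Tsum A n.
Proof.
move=> D0 Dn.
have D_le_n : D <= n by apply: leq_trans (ltnW Dn); rewrite -{1}(expn1 D) leq_pexp2l.
apply: leq_trans (leq_mul (leqnn D) (npart_remove A D0 Dn)) _.
rewrite mulnDr mul2n -addnn; apply: leq_add.
  rewrite big_distrr big_mkcond /Tsum big_ord_recl mul0n add0n /=.
  apply: leq_sum => i _; case: ifP => // Di.
  by rewrite mul1n leq_mul2r Di orbT.
rewrite -(leq_pmul2l D0) -[X in _ <= X](sum_ord_lt _ D_le_n) !big_distrr /=.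
apply: leq_sum => i _; case: ifP => [Di|]; last by rewrite !muln0.
apply: leq_trans (leq_Tsum A Di); rewrite mulnA leq_mul2r mulnn.
by rewrite leq_pmulr ?orbT.
Qed.

Lemma TsumS A n : A 1 -> Tsum (no1 A) n.+1 = Tsum (no1 A) n + npart A n.
Proof.
move=> A1; rewrite /Tsum big_ord_recl mul0n add0n npart_sum // -big_split /=.
by apply: eq_bigr => i _; rewrite subSS mulSn addnC.
Qed.

Lemma leq_Tsum_mono A m n : A 1 -> m <= n -> Tsum (no1 A) m <= Tsum (no1 A) n.
Proof.
move=> A1; elim: n => [|n IH]; first by rewrite leqn0 => /eqP ->.
rewrite leq_eqVlt => /orP [/eqP -> //|]; rewrite ltnS => /IH h.
by apply: leq_trans h _; rewrite TsumS // leq_addr.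
Qed.

Lemma Tsum_dominates A C : A 1 ->
  exists N, forall n, N <= n -> C * npart A n < Tsum (no1 A) n.
Proof.
(* The terms with [x >= K] cost one [Tsum] after multiplication by [K]. The [K] terms with [x < K]
   cost two in total: [D = K ^ 2] pays once for their number and once for the multiplier. *)
move=> A1; pose K := (3 * C).+1; pose D := K ^ 2.
have K0 : 0 < K by []. have D0 : 0 < D by rewrite expn_gt0.
exists (D ^ 4 + K).+1 => n nN.
suff h : K * npart A n <= 3 * Tsum (no1 A) n.
  by have := npart_gt0 n A1; rewrite /K in h; nia.
rewrite (npart_sum _ A1) (bigID (fun x : 'I_n.+1 => x < K)) /= mulnDr.
rewrite (_ : 3 * _ = 2 * Tsum (no1 A) n + Tsum (no1 A) n); last by lia.
apply: leq_add; last first.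
  rewrite big_distrr big_mkcond /=; apply: leq_sum => i _.
  by case: ifP => //; rewrite -leqNgt => Ki; rewrite leq_mul2r Ki orbT.
rewrite -(leq_pmul2l K0) mulnA mulnn -/D big_distrr /=.
rewrite -[X in _ <= X](@sum_ord_lt n.+1 K) //; last by lia.
apply: leq_sum => i iK.
apply: leq_trans (npart_le_Tsum (no1 A) D0 (_ : _ < n - i)) _; first by lia.
by rewrite leq_mul2l leq_Tsum_mono ?orbT // leq_subr.
Qed.

(** [M] lets a gain of any positive slope be stated in natural numbers; the bounded error adds up to
    [C * npart A n], which [Tsum_dominates] absorbs. *)
Lemma succ_of_Afun k t r s M C : 2 <= k ->
  (forall x, M * Afun k t s x + x <= M * Afun k t r x + C) -> succ_kt k t r s.
Proof.
move=> k2 h; set A := fun d => ~~ (k %| d).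
have A1 : A 1 by rewrite /A dvdn1; lia.
have [N hN] := Tsum_dominates C A1; exists N => n /hN.
rewrite !Dx_Afun // -/A => hn.
set Ds := \sum_(x < _) _; set Dr := \sum_(x < _) _.
have : M * Ds + Tsum (no1 A) n <= M * Dr + C * npart A n.
  rewrite npart_sum // /Tsum !big_distrr -!big_split /=; apply: leq_sum => x _.
  by rewrite !mulnA -!mulnDl leq_mul2r h orbT.
by nia.
Qed.

(** * From series to biases *)

Lemma sum_residue t r J (f : nat -> nat) : 0 < r <= t ->
  \sum_(i < J * t | i.+1 == r %[mod t]) f i.+1 = \sum_(j < J) f (r + j * t).
Proof.
case/andP=> r0 rt; elim: J => [|J IH]; first by rewrite !big_ord0.
rewrite big_ord_recr /= -IH mulSn addnC big_split_ord /=; congr (_ + _).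
have rt' : r.-1 < t by rewrite prednK.
rewrite (big_pred1 (Ordinal rt')) /=; first by rewrite -addnS prednK // addnC.
move=> i /=; rewrite -addnS modnMDl; transitivity (i == r.-1 :> nat) => //.
have [it|] := ltnP i.+1 t; last first.
  move=> ti; have it : i.+1 = t by apply/eqP; rewrite eqn_leq ti ltn_ord.
  rewrite it modnn; have [rt''|tr] := ltnP r t; first by rewrite modn_small //; lia.
  by rewrite (_ : r = t) ?modnn; lia.
rewrite modn_small //; have [rt''|tr] := ltnP r t; first by rewrite modn_small //; lia.
by rewrite (_ : r = t) ?modnn; lia.
Qed.

Lemma eqn_mod_coprime k t a b : coprime k t ->
  (k * a == k * b %[mod t]) = (a == b %[mod t]).
Proof.
move=> kt; wlog ab : a b / b <= a.
  by move=> W; case/orP: (leq_total b a) => /W //; rewrite eq_sym => ->; rewrite eq_sym.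
by rewrite !eqn_mod_dvd ?leq_mul2l ?ab ?orbT // -mulnBr Gauss_dvdr // coprime_sym.
Qed.

(* The parts [d = r (mod t)] divisible by [k] are the [k * e] with [e = r' (mod t)]. *)
Lemma Afun_residue k t r r' x J : 0 < k -> coprime k t -> 0 < r <= t -> 0 < r' <= t ->
  k * r' = r %[mod t] -> x <= k * J * t ->
  Afun k t r x + \sum_(j < J) x %/ (k * (r' + j * t)) =
  \sum_(j < k * J) x %/ (r + j * t).
Proof.
move=> k0 kt rt r't rr' xJ.
rewrite -(sum_residue (k * J) (fun d => x %/ d) rt).
rewrite [RHS](bigID (fun i : 'I_(k * J * t) => k %| i.+1)) /= [RHS]addnC; congr (_ + _).
  by rewrite -(Afun_widen k t r xJ); apply: eq_bigl => i; rewrite andbC.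
rewrite -(sum_residue J (fun e => x %/ (k * e)) r't).
(* The multiples of [k] are the class of [k] modulo [k], so [sum_residue] also enumerates them. *)
have kk : 0 < k <= k by rewrite k0 leqnn.
have := sum_residue (J * t) (fun d => if d == r %[mod t] then x %/ d else 0) kk.
rewrite mulnC mulnA -!big_mkcond -!big_mkcondr /= => E.
rewrite [RHS](_ : _ = \sum_(i < k * J * t |
   (i.+1 == k %[mod k]) && (i.+1 == r %[mod t])) x %/ i.+1); last first.
  by apply: eq_bigl => i; rewrite andbC modnn.
rewrite E; apply: eq_big => [i|i _].
  by rewrite -mulSn (mulnC i.+1 k) -rr' eqn_mod_coprime.
by rewrite -mulSn (mulnC i.+1 k).
Qed.

(** Beyond the first [n] terms, each [s]-term after the first is at most the preceding [r]-term, so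
    the tails cost one boundary value, whatever [m] is. *)
Lemma sum_interlace (g : nat -> nat) r s t n m :
  (forall a b, 0 < a -> a <= b -> g b <= g a) -> 0 < r -> r <= s + t ->
  \sum_(j < n + m) g (s + j * t) + \sum_(j < n) g (r + j * t) <=
  \sum_(j < n) g (s + j * t) + \sum_(j < n + m) g (r + j * t) + g (s + n * t).
Proof.
move=> gd r0 rst; rewrite !big_split_ord /=.
rewrite addnAC [X in _ <= X + _]addnA -[X in _ <= X]addnA leq_add2l.
case: m => [|m]; first by rewrite big_ord0.
rewrite big_ord_recl addn0 addnC leq_add2r.
rewrite [X in _ <= X]big_ord_recr /=; apply: leq_trans (leq_addr _ _).
by apply: leq_sum => i _; apply: gd; rewrite /bump /= ?addn_gt0 ?r0 //; nia.
Qed.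

(** * Passage to finite sums of reals *)

Lemma INR_addn a b : INR (a + b) = (INR a + INR b)%R.
Proof. exact: plus_INR. Qed.

Lemma INR_muln a b : INR (a * b) = (INR a * INR b)%R.
Proof. exact: mult_INR. Qed.

Lemma INR_leq a b : a <= b -> (INR a <= INR b)%R.
Proof. by move=> /leP; apply: le_INR. Qed.

Lemma INR_leq_inv a b : (INR a <= INR b)%R -> a <= b.
Proof. by move=> h; apply/leP; apply: INR_le. Qed.

Lemma INR_pos a : 0 < a -> (0 < INR a)%R.
Proof. by move=> /ltP; apply: lt_0_INR. Qed.

Lemma INR_bounded (y : R) : exists n, (y <= INR n)%R.
Proof.
by have [n hn] := INR_unbounded y; exists n; apply/Rlt_le/hn.
Qed.

Fixpoint rsum (f : nat -> R) (n : nat) : R :=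
  if n is m.+1 then (rsum f m + f m)%R else 0%R.

Lemma rsumS f n : rsum f n.+1 = (rsum f n + f n)%R.
Proof. by []. Qed.

Lemma INR_sum n (f : nat -> nat) :
  INR (\sum_(j < n) f j) = rsum (fun j => INR (f j)) n.
Proof. by elim: n => [|n IH] /=; rewrite ?big_ord0 // big_ord_recr INR_addn IH. Qed.

Lemma eq_rsum n (f g : nat -> R) :
  (forall j, j < n -> f j = g j) -> rsum f n = rsum g n.
Proof.
elim: n => //= n IH fg; rewrite IH ?fg // => j jn; exact/fg/ltnW.
Qed.

Lemma rsum_le n (f g : nat -> R) :
  (forall j, j < n -> (f j <= g j)%R) -> (rsum f n <= rsum g n)%R.
Proof.
elim: n => [|n IH] fg /=; first by apply: Rle_refl.
by apply: Rplus_le_compat; [apply: IH => j jn; apply/fg/ltnW|apply: fg].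
Qed.

Lemma rsum_mull n (c : R) (f : nat -> R) : rsum (fun j => c * f j)%R n = (c * rsum f n)%R.
Proof. by elim: n => [|n IH] /=; rewrite ?IH; lra. Qed.

Lemma rsum_minus n (f g : nat -> R) :
  rsum (fun j => f j - g j)%R n = (rsum f n - rsum g n)%R.
Proof. by elim: n => [|n IH] /=; rewrite ?IH; lra. Qed.

Lemma rsum_const n (c : R) : rsum (fun=> c) n = (INR n * c)%R.
Proof.
elim: n => [|n IH]; first by rewrite /=; lra.
by rewrite S_INR [LHS]/= IH; lra.
Qed.

Definition rsums (t r n : nat) : R := rsum (fun j => / INR (r + j * t))%R n.

Lemma INR_div_bounds x d : 0 < d ->
  (INR x * / INR d - 1 <= INR (x %/ d) <= INR x * / INR d)%R.
Proof.
move=> d0; have dR := INR_pos d0.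
have e : (INR x = INR (x %/ d) * INR d + INR (x %% d))%R.
  by rewrite -INR_muln -INR_addn -divn_eq.
have h1 : (0 <= INR (x %% d))%R by apply: pos_INR.
have h2 : (INR (x %% d) < INR d)%R by apply: lt_INR; apply/ltP; rewrite ltn_mod.
have hd : (INR d * / INR d = 1)%R by field; lra.
have hi := Rinv_0_lt_compat _ dR.
have E : (INR x * / INR d = INR (x %/ d) + INR (x %% d) * / INR d)%R.
  by rewrite e Rmult_plus_distr_r Rmult_assoc hd; lra.
have h3 := Rmult_lt_compat_r _ _ _ hi h2.
have h4 := Rmult_le_pos _ _ h1 (Rlt_le _ _ hi).
by rewrite E; split; lra.
Qed.

Lemma INR_sum_div x c t r n : 0 < r -> 0 < c ->
  (INR x / INR c * rsums t r n - INR n <=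
   INR (\sum_(j < n) x %/ (c * (r + j * t))) <= INR x / INR c * rsums t r n)%R.
Proof.
move=> r0 c0; have cR := INR_pos c0.
have rj j : 0 < r + j * t by rewrite addn_gt0 r0.
have E j : (INR x / INR c * / INR (r + j * t) = INR x * / INR (c * (r + j * t)))%R.
  by rewrite INR_muln; field; have := INR_pos (rj j); split; lra.
rewrite (INR_sum n (fun j => x %/ (c * (r + j * t)))) /rsums -rsum_mull.
have cr j : 0 < c * (r + j * t) by rewrite muln_gt0 c0 rj.
split.
  rewrite -[INR n]Rmult_1_r -rsum_const -rsum_minus.
  by apply: rsum_le => j _; rewrite E; have := @INR_div_bounds x _ (cr j); lra.
by apply: rsum_le => j _; rewrite E; have := @INR_div_bounds x _ (cr j); lra.
Qed.

Lemma INR_sum_div1 x t r n : 0 < r ->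
  (INR x * rsums t r n - INR n <=
   INR (\sum_(j < n) x %/ (r + j * t)) <= INR x * rsums t r n)%R.
Proof.
move=> r0; have := @INR_sum_div x 1 t r n r0 isT.
rewrite (_ : (INR x / INR 1)%R = INR x); last by rewrite /=; field.
by rewrite (eq_bigr (fun j : 'I_n => x %/ (r + j * t))) // => j _; rewrite mul1n.
Qed.

(** The sums are cut at lengths independent of [x]. Before the cut each floor costs at most 1; after
    it, interlacing leaves two quotients of size at most [x / (k * J)], which become [2 / INR J]
    after multiplication by [k]. *)
Lemma Afun_gap k t r s r' s' x J : 0 < k -> coprime k t ->
  0 < r <= t -> 0 < s <= t -> 0 < r' <= t -> 0 < s' <= t ->
  k * r' = r %[mod t] -> k * s' = s %[mod t] -> 0 < J ->
  (INR x * (INR k * (rsums t r (k * J) - rsums t s (k * J))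
             - (rsums t r' J - rsums t s' J) - 2 / INR J)
   - INR (k * (k * J + J)) <= INR k * (INR (Afun k t r x) - INR (Afun k t s x)))%R.
Proof.
move=> k0 kt rt st r't s't rr' ss' J0.
have t0 : 0 < t by case/andP: rt; lia.
(* With [J + x] blocks every divisor up to [x] is covered; the cut comes after [J] of them. *)
have xJ : x <= k * (J + x) * t.
  by rewrite mulnAC; apply: leq_trans (leq_addl J x) _; rewrite leq_pmull // muln_gt0 k0.
have Er := Afun_residue k0 kt rt r't rr' xJ.
have Es := Afun_residue k0 kt st s't ss' xJ.
rewrite mulnDr in Er Es.
have [/andP [r0 rt'] /andP [s0 st']] := (rt, st).
have [/andP [r'0 r't'] /andP [s'0 s't']] := (r't, s't).
have Irs := @sum_interlace (fun d => x %/ d) r s t (k * J) (k * x)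
  (fun a b => @leq_div2l x a b) r0 (leq_trans rt' (leq_addl _ _)).
have kd a b : 0 < a -> a <= b -> x %/ (k * b) <= x %/ (k * a).
  by move=> a0 ab; rewrite leq_div2l ?muln_gt0 ?k0 // leq_mul2l ab orbT.
(* The multiples of [k] are subtracted, so here [r'] and [s'] exchange roles. *)
have Irs' := @sum_interlace (fun d => x %/ (k * d)) s' r' t J x
  kd s'0 (leq_trans s't' (leq_addl _ _)).
set q1 := x %/ (s + k * J * t) in Irs; set q2 := x %/ (k * (r' + J * t)) in Irs'.
have main : Afun k t s x + \sum_(j < k * J) x %/ (r + j * t)
              + \sum_(j < J) x %/ (k * (s' + j * t)) <=
   Afun k t r x + \sum_(j < k * J) x %/ (s + j * t)
              + \sum_(j < J) x %/ (k * (r' + j * t)) + q1 + q2.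
  have comb a b c d e f g h i l (q p : nat) : a + b = c -> d + e = f ->
    c + g <= h + f + q -> e + i <= l + b + p -> a + g + i <= d + h + l + q + p.
    by clear; lia.
  cbv beta in Irs, Irs'.
  exact (comb _ _ _ _ _ _ _ _ _ _ _ _ Es Er Irs Irs').
have {}main := INR_leq main.
rewrite !INR_addn in main.
have Br := INR_sum_div1 x t (k * J) r0.
have Bs := INR_sum_div1 x t (k * J) s0.
rewrite INR_muln in Br; rewrite INR_muln in Bs.
have Br' := INR_sum_div x t J r'0 k0.
have Bs' := INR_sum_div x t J s'0 k0.
have kR := INR_pos k0; have JR := INR_pos J0.
have Bq d : k * J <= d -> (INR k * INR (x %/ d) <= INR x * / INR J)%R.
  move=> kJd; have d0 : 0 < d by apply: leq_trans kJd; rewrite muln_gt0 k0.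
  apply: Rle_trans (_ : INR k * (INR x * / (INR k * INR J)) <= _)%R; last first.
    by apply: Req_le; field; lra.
  apply: Rmult_le_compat_l; first lra.
  apply: Rle_trans (proj2 (INR_div_bounds x d0)) _.
  apply: Rmult_le_compat_l; first exact: pos_INR.
  by rewrite -INR_muln; apply: Rinv_le_contravar; [apply/INR_pos; rewrite muln_gt0 k0|apply: INR_leq].
have B1 : (INR k * INR q1 <= INR x * / INR J)%R.
  by apply: Bq; apply: leq_trans (leq_addl _ _); rewrite leq_pmulr.
have B2 : (INR k * INR q2 <= INR x * / INR J)%R.
  by apply: Bq; rewrite leq_mul2l; apply/orP; right; apply: leq_trans (leq_addl _ _); rewrite leq_pmulr.
have xk : (INR k * (INR x / INR k) = INR x)%R by field; lra.
rewrite INR_muln INR_addn INR_muln.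
set Y := (INR x / INR k)%R in Br' Bs' xk.
have h : (INR x * rsums t r (k * J) - INR k * INR J + (Y * rsums t s' J - INR J)
          - INR x * rsums t s (k * J) - Y * rsums t r' J - INR q1 - INR q2 <=
          INR (Afun k t r x) - INR (Afun k t s x))%R by lra.
have := Rmult_le_compat_l _ _ _ (Rlt_le _ _ kR) h.
have e1 : (INR k * (Y * rsums t s' J) = INR x * rsums t s' J)%R.
  by rewrite -xk; ring.
have e2 : (INR k * (Y * rsums t r' J) = INR x * rsums t r' J)%R.
  by rewrite -xk; ring.
rewrite /Rdiv; lra.
Qed.

(* Up to the factor [t], the bracket tends to the coefficient deciding the order. *)
Lemma succ_of_gap k t r s r' s' (eps : R) : 2 <= k -> coprime k t ->
  0 < r <= t -> 0 < s <= t -> 0 < r' <= t -> 0 < s' <= t ->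
  k * r' = r %[mod t] -> k * s' = s %[mod t] -> (0 < eps)%R ->
  (forall J0, exists2 J, J0 <= J & (eps <=
     INR k * (rsums t r (k * J) - rsums t s (k * J))
       - (rsums t r' J - rsums t s' J))%R) ->
  succ_kt k t r s.
Proof.
move=> k2 kt rt st r't s't rr' ss' eps0 gap.
have k0 : 0 < k by exact: ltnW. have kR := INR_pos k0.
(* This bound makes [2 / INR J] at most [eps / 2]; below, [M] is chosen so that the remaining slope
   satisfies [INR M * (eps / 2) >= INR k]. *)
have [J0 hJ0] := INR_bounded (4 / eps).
have [J JJ0 hJ] := gap J0.+1.
have J0' : 0 < J by apply: leq_trans JJ0.
have JR := INR_pos J0'.
have JJ : (4 / eps <= INR J)%R by apply: Rle_trans hJ0 (INR_leq (ltnW JJ0)).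
have [M hM] := INR_bounded (2 * INR k / eps).
pose C := M * (k * J + J).
apply: (@succ_of_Afun k t r s M C) => // x; apply: INR_leq_inv.
have := Afun_gap x k0 kt rt st r't s't rr' ss' J0'.
rewrite /C !INR_addn !INR_muln !INR_addn INR_muln.
move: hJ; set L := (X in (_ <= X)%R -> _) => hJ; rewrite -/L; clearbody L.
have := pos_INR x; have := pos_INR M.
move: (INR (Afun k t r x)) (INR (Afun k t s x)) => ar as_.
have J2 : (2 / INR J <= eps / 2)%R.
  have := Rmult_le_compat_r _ _ _ (Rlt_le _ _ eps0) JJ.
  rewrite (_ : (4 / eps * eps = 4)%R); last by field; lra.
  move=> J4; apply: (Rmult_le_reg_r (INR J)) => //.
  by rewrite (_ : (2 / INR J * INR J = 2)%R); [clear -J4; lra|field; apply: Rgt_not_eq].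
have M2 : (2 * INR k <= INR M * eps)%R.
  have := Rmult_le_compat_r _ _ _ (Rlt_le _ _ eps0) hM.
  by rewrite (_ : (2 * INR k / eps * eps = 2 * INR k)%R) //; field; lra.
move: (INR x) (INR M) M2 => X m M2 m0 X0 h.
have h1 : (X * (eps / 2) - INR k * (INR k * INR J + INR J) <= INR k * (ar - as_))%R.
  have : (X * (eps / 2) <= X * (L - 2 / INR J))%R by apply: Rmult_le_compat_l; lra.
  by lra.
have h2 := Rmult_le_compat_l _ _ _ m0 h1.
have h3 := Rmult_le_compat_l _ _ _ X0 M2.
by apply: (Rmult_le_reg_l _ _ _ kR); lra.
Qed.

(** * The value of zeta(2) *)

Lemma rsum_add f m n : rsum f (m + n) = (rsum f m + rsum (fun j => f (m + j)%N) n)%R.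
Proof.
elim: n => [|n IH] /=; first by rewrite addn0; lra.
by rewrite addnS /= IH; lra.
Qed.

Lemma rsum_rev f n : rsum (fun j => f (n.-1 - j)) n = rsum f n.
Proof.
elim: n f => [//|n IH] f; rewrite -[in LHS]add1n rsum_add /= add0n subn0.
rewrite -(IH f) Rplus_0_l Rplus_comm; congr (_ + _)%R.
apply: eq_rsum => j jn; congr f; lia.
Qed.

Lemma rsum_plus n (f g : nat -> R) :
  rsum (fun j => f j + g j)%R n = (rsum f n + rsum g n)%R.
Proof. by elim: n => [|n IH] /=; rewrite ?IH; lra. Qed.

Lemma rsum_leq f m n : (forall j, (0 <= f j)%R) -> m <= n -> (rsum f m <= rsum f n)%R.
Proof.
move=> f0 mn; rewrite -(subnKC mn) rsum_add.
have := @rsum_le (n - m) (fun=> 0)%R _ (fun j _ => f0 (m + j)).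
by rewrite rsum_const; lra.
Qed.

(** The function [sin y - y * cos y] vanishes at 0 and has derivative [y * sin y]. *)
Lemma xcosx_le_sinx x : (0 < x)%R -> (x < PI / 2)%R -> (x * cos x <= sin x)%R.
Proof.
move=> x0 x2.
have [|c [e [c0 cx]]] := @MVT_cor2 (fun y => sin y - y * cos y)%R
  (fun y => cos y - (1 * cos y + y * - sin y))%R 0 x x0.
  move=> c _; apply: derivable_pt_lim_minus; first exact: derivable_pt_lim_sin.
  apply: (derivable_pt_lim_mult id cos); first exact: derivable_pt_lim_id.
  exact: derivable_pt_lim_cos.
have s0 : (0 < sin c)%R by apply: sin_gt_0; lra.
move: e; rewrite sin_0 => e.
have : (0 <= c * sin c * x)%R by apply: Rmult_le_pos; [apply: Rmult_le_pos|]; lra.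
lra.
Qed.

(** Since [1 / sin^2 x = 1 + cot^2 x], the upper bound says that [cot x <= 1 / x]. *)
Lemma inv_sin2_bounds x : (0 < x)%R -> (x < PI / 2)%R ->
  (/ x ^ 2 <= / sin x ^ 2 <= / x ^ 2 + 1)%R.
Proof.
move=> x0 x2; have s0 : (0 < sin x)%R by apply: sin_gt_0; lra.
have c0 : (0 < cos x)%R by apply: cos_gt_0; lra.
have sx := sin_lt_x x x0; have xc := xcosx_le_sinx x0 x2.
have x2p : (0 < x ^ 2)%R by nra.
have s2p : (0 < sin x ^ 2)%R by nra.
split; first by apply: Rinv_le_contravar => //; nra.
have e : (sin x ^ 2 + cos x ^ 2 = 1)%R by have := sin2_cos2 x; rewrite /Rsqr; lra.
have h : (x ^ 2 * cos x ^ 2 <= sin x ^ 2)%R.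
  rewrite -Rpow_mult_distr; apply: pow_incr; split => //.
  by apply: Rmult_le_pos; lra.
apply: (Rmult_le_reg_r (x ^ 2 * sin x ^ 2)); first nra.
rewrite (_ : (/ sin x ^ 2 * (x ^ 2 * sin x ^ 2) = x ^ 2)%R); last by field; lra.
rewrite (_ : ((/ x ^ 2 + 1) * (x ^ 2 * sin x ^ 2) = sin x ^ 2 + x ^ 2 * sin x ^ 2)%R); last by field; lra.
nra.
Qed.

Lemma inv_sin2_half x : (0 < x)%R -> (x < PI)%R ->
  (/ sin (x / 2) ^ 2 + / sin (PI / 2 - x / 2) ^ 2 = 4 * / sin x ^ 2)%R.
Proof.
move=> x0 x2.
have s0 : (0 < sin (x / 2))%R by apply: sin_gt_0; lra.
have c0 : (0 < cos (x / 2))%R by apply: cos_gt_0; lra.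
rewrite sin_shift (_ : sin x = 2 * sin (x / 2) * cos (x / 2))%R; last first.
  by rewrite -sin_2a; congr sin; field.
have e : (sin (x / 2) ^ 2 + cos (x / 2) ^ 2 = 1)%R.
  by have := sin2_cos2 (x / 2); rewrite /Rsqr; lra.
transitivity ((sin (x / 2) ^ 2 + cos (x / 2) ^ 2) /
              (sin (x / 2) ^ 2 * cos (x / 2) ^ 2))%R; first by field; lra.
by rewrite e; field; lra.
Qed.

(** For [k < 2 ^ n], these are the angles reached from [PI / 4] in [n] steps, each replacing [x] by
    [x / 2] and [PI / 2 - x / 2]. *)
Definition odd_angle (n k : nat) : R := (INR (2 * k + 1) * PI / (4 * 2 ^ n))%R.

Lemma INR_expn2 n : INR (2 ^ n) = (2 ^ n)%R.
Proof. by elim: n => [//|n IH]; rewrite expnS INR_muln IH. Qed.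

Lemma odd_angle_bounds n k : k < 2 ^ n ->
  (0 < odd_angle n k)%R /\ (odd_angle n k < PI / 2)%R.
Proof.
move=> kn; have p := PI_RGT_0; rewrite /odd_angle.
have t0 : (0 < 2 ^ n)%R by apply: pow_lt; lra.
have k0 : (0 < INR (2 * k + 1))%R by apply: INR_pos; rewrite addn1.
have kn' : (INR (2 * k + 1) < 2 * 2 ^ n)%R.
  rewrite -INR_expn2 -(INR_muln 2); apply/lt_INR/ltP; lia.
split; first by apply: Rdiv_lt_0_compat; nra.
apply: (Rmult_lt_reg_r (4 * 2 ^ n)); first lra.
rewrite /Rdiv Rmult_assoc Rinv_l; last lra.
by nra.
Qed.

(* Iterating [4 / sin^2 x = 1 / sin^2 (x/2) + 1 / cos^2 (x/2)] from [x = PI/4]. *)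
Lemma sum_inv_sin2 n :
  rsum (fun k => / sin (odd_angle n k) ^ 2)%R (2 ^ n) = (2 * 4 ^ n)%R.
Proof.
elim: n => [|n IH].
  rewrite /= /odd_angle (_ : INR (2 * 0 + 1) * PI / (4 * 2 ^ 0) = PI / 4)%R /=; last by field.
  rewrite sin_PI4; have := sqrt_lt_R0 2 ltac:(lra); have := sqrt_sqrt 2 ltac:(lra).
  move=> e s0; rewrite (_ : (1 / sqrt 2 * (1 / sqrt 2 * 1) = / (sqrt 2 * sqrt 2))%R); last by field; lra.
  by rewrite e; field.
have p := PI_RGT_0.
rewrite (_ : 2 ^ n.+1 = 2 ^ n + 2 ^ n); last by rewrite expnS mul2n addnn.
have t0 : (0 < 2 ^ n)%R by apply: pow_lt; lra.
(* The reflection [PI / 2 - x / 2] of the [k]-th half angle is the [k]-th from the end, so the upper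
   half of the sum is reversed before pairing. *)
rewrite rsum_add -[X in (_ + X)%R]rsum_rev -rsum_plus.
rewrite (eq_rsum (g := fun k => (4 * / sin (odd_angle n k) ^ 2)%R)).
  by rewrite rsum_mull IH /=; ring.
move=> k kn; have [x0 x1] := odd_angle_bounds kn.
rewrite -inv_sin2_half //; last by lra.
congr (/ sin _ ^ 2 + / sin _ ^ 2)%R; first by rewrite /odd_angle /=; field; lra.
rewrite /odd_angle.
have e : (INR (2 * (2 ^ n + ((2 ^ n).-1 - k)) + 1) + INR (2 * k + 1) = 4 * 2 ^ n)%R.
  rewrite -INR_addn -INR_expn2 (_ : 4%R = INR 4); last by rewrite /=; lra.
  by rewrite -INR_muln; congr INR; lia.
rewrite (_ : INR (2 * (2 ^ n + ((2 ^ n).-1 - k)) + 1) = 4 * 2 ^ n - INR (2 * k + 1))%R; last lra.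
by rewrite /=; field; lra.
Qed.

Definition zeta2 n : R := rsum (fun j => / INR j.+1 ^ 2)%R n.
Definition odd2 n : R := rsum (fun j => / INR (2 * j + 1) ^ 2)%R n.

(** [inv_sin2_bounds] is summed over the odd angles: the sum of [1 / x^2] is [16 * 4^n / PI^2] times
    [odd2 (2 ^ n)], that of [1 / sin^2 x] is [2 * 4^n], and the slack is [2^n]. [PI <= 4] simplifies
    the error. *)
Lemma odd2_bounds n :
  (odd2 (2 ^ n) <= PI ^ 2 / 8 /\ PI ^ 2 / 8 - / 2 ^ n <= odd2 (2 ^ n))%R.
Proof.
have p := PI_RGT_0; have p4 := PI_4.
have t0 : (0 < 2 ^ n)%R by apply: pow_lt; lra.
have e4 : (4 ^ n = 2 ^ n * 2 ^ n)%R by rewrite -Rpow_mult_distr; congr (_ ^ _)%R; lra.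
have E : (rsum (fun k => / odd_angle n k ^ 2)%R (2 ^ n) =
          16 * 4 ^ n / PI ^ 2 * odd2 (2 ^ n))%R.
  rewrite /odd2 -rsum_mull; apply: eq_rsum => k _; rewrite /odd_angle e4.
  have k0 : (0 < INR (2 * k + 1))%R by apply: INR_pos; rewrite addn1.
  by field; lra.
have B k : k < 2 ^ n -> _ := fun h =>
  inv_sin2_bounds (proj1 (odd_angle_bounds h)) (proj2 (odd_angle_bounds h)).
have lo := rsum_le (fun k h => proj1 (B k h)).
have hi := rsum_le (fun k h => proj2 (B k h)).
rewrite rsum_plus rsum_const INR_expn2 in hi.
rewrite sum_inv_sin2 E e4 in lo hi.
set T := (2 ^ n)%R in t0 lo hi *; set O := odd2 _ in lo hi *.
have c : (0 < PI ^ 2)%R by nra.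
have c16 : (PI ^ 2 <= 16)%R by nra.
have TT : (0 < T * T)%R by nra.
split.
  apply: (Rmult_le_reg_l (16 * (T * T) / PI ^ 2)).
    by apply: Rdiv_lt_0_compat; lra.
  rewrite [X in (_ <= X)%R](_ : _ = 2 * (T * T))%R //; field; lra.
apply: (Rmult_le_reg_l (16 * (T * T) / PI ^ 2)).
  by apply: Rdiv_lt_0_compat; lra.
rewrite (_ : (16 * (T * T) / PI ^ 2 * (PI ^ 2 / 8 - / T) = 2 * (T * T) - 16 / PI ^ 2 * T)%R); last by field; lra.
have : (1 <= 16 / PI ^ 2)%R.
  by apply: (Rmult_le_reg_r (PI ^ 2)) => //; rewrite (_ : (16 / PI ^ 2 * PI ^ 2 = 16)%R); [lra|field; lra].
nra.
Qed.

Lemma zeta2_double n : zeta2 (2 * n) = (odd2 n + zeta2 n / 4)%R.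
Proof.
elim: n => [|n IH]; first by rewrite /zeta2 /odd2 /=; lra.
have zS m : zeta2 m.+1 = (zeta2 m + / INR m.+1 ^ 2)%R by [].
have oS : odd2 n.+1 = (odd2 n + / INR (2 * n + 1) ^ 2)%R by [].
rewrite (_ : 2 * n.+1 = (2 * n).+2); last by lia.
rewrite !zS oS IH addn1 (_ : (2 * n).+2 = 2 * n.+1); last by lia.
have := INR_pos (ltn0Sn n); have := INR_pos (ltn0Sn (2 * n)).
move=> h1 h2; rewrite INR_muln (_ : INR 2 = 2%R) //.
by field; lra.
Qed.

Lemma zeta2_mono m n : m <= n -> (zeta2 m <= zeta2 n)%R.
Proof.
apply: rsum_leq => j; apply/Rlt_le/Rinv_0_lt_compat/pow_lt; exact: INR_pos.
Qed.

(** By monotonicity and [zeta2_double], three quarters of [zeta2 (2 ^ n)] is at most [odd2 (2 ^ n)],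
    hence at most [PI^2 / 8]. *)
Lemma zeta2_le n : (zeta2 n <= PI ^ 2 / 6)%R.
Proof.
have n2 : n <= 2 ^ n by apply/ltnW/ltn_expl.
have h : 2 ^ n <= 2 * 2 ^ n by rewrite leq_pmull.
have := zeta2_mono n2; have := zeta2_mono h; rewrite zeta2_double.
by have [] := odd2_bounds n; lra.
Qed.

(** Passing from [2 ^ n] to [2 * 2 ^ n] terms adds at most [/ 2 ^ n], so [zeta2_double] can be
    solved for [zeta2] up to an error of at most [2 * / 2 ^ n]. *)
Lemma zeta2_ge (eps : R) : (0 < eps)%R ->
  exists N, forall n, N <= n -> (PI ^ 2 / 6 - eps <= zeta2 n)%R.
Proof.
move=> e0; have [n hn] := INR_bounded (2 / eps).
exists (2 * 2 ^ n) => m /zeta2_mono; apply: Rle_trans.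
have [_ lo] := odd2_bounds n.
have t0 : (0 < 2 ^ n)%R by apply: pow_lt; lra.
have tn : (INR n <= 2 ^ n)%R by rewrite -INR_expn2; apply/INR_leq/ltnW/ltn_expl.
have h : (zeta2 (2 * 2 ^ n) - zeta2 (2 ^ n) <= / 2 ^ n)%R.
  rewrite mul2n -addnn /zeta2 rsum_add.
  have := @rsum_le (2 ^ n) (fun j => / INR (2 ^ n + j).+1 ^ 2)%R (fun=> / (2 ^ n * 2 ^ n))%R.
  rewrite rsum_const INR_expn2 => /(_ _).
  rewrite (_ : (2 ^ n * / (2 ^ n * 2 ^ n) = / 2 ^ n)%R); last by field; lra.
  move=> H; suff : (rsum (fun j => / INR (2 ^ n + j).+1 ^ 2)%R (2 ^ n) <= / 2 ^ n)%R by lra.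
  apply: H => j _; apply: Rinv_le_contravar; first nra.
  rewrite -INR_expn2; have : (INR (2 ^ n) <= INR (2 ^ n + j).+1)%R by apply: INR_leq; lia.
  by have := pos_INR (2 ^ n); nra.
move: h lo; rewrite zeta2_double => h lo.
have e2 : (2 * / 2 ^ n <= eps)%R.
  apply: (Rmult_le_reg_r (2 ^ n)) => //; rewrite Rmult_assoc Rinv_l; last lra.
  have := Rmult_le_compat_r _ _ _ (Rlt_le _ _ e0) (Rle_trans _ _ _ hn tn).
  by rewrite (_ : (2 / eps * eps = 2)%R); [lra|field; lra].
lra.
Qed.

(** * Comparing the two series *)

Lemma residue_preimage k t r : coprime k t -> 0 < t ->
  exists2 r', 0 < r' <= t & k * r' = r %[mod t].
Proof.
move=> kt t0; pose x := chinese k t 0 r.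
have /dvdnP [y xy] : k %| x by rewrite /dvdn chinese_modl // mod0n.
have xr : x = r %[mod t] by rewrite chinese_modr.
have yr : k * y = r %[mod t] by rewrite mulnC -xy.
(* Representatives run from 1 to [t], so [t] replaces the remainder 0. *)
case: (posnP (y %% t)) => [y0|y0].
  exists t; first by rewrite t0 leqnn.
  by rewrite -yr modnMl -modnMmr y0 muln0 mod0n.
exists (y %% t); first by rewrite y0 ltnW // ltn_mod.
by rewrite modnMmr.
Qed.

Lemma rsums_minus t r s n : (rsums t r n - rsums t s n)%R =
  rsum (fun j => / INR (r + j * t) - / INR (s + j * t))%R n.
Proof. by rewrite rsum_minus. Qed.

Lemma INR_inv_leq a b : 0 < a -> a <= b -> (/ INR b <= / INR a)%R.
Proof. by move=> a0 ab; apply: Rinv_le_contravar; [apply: INR_pos|apply: INR_leq]. Qed.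

Lemma INR_inv_lt a b : 0 < a -> a < b -> (/ INR b < / INR a)%R.
Proof.
move=> a0 ab; have h := INR_pos a0; have h' := INR_pos (leq_trans a0 (ltnW ab)).
by apply: Rinv_lt_contravar; [nra|apply/lt_INR/ltP].
Qed.

(** As [s <= t], each later [r]-term is at most the preceding [s]-term; only the first one, [1 / r],
    survives. *)
Lemma rsums_diff_ub t r s n : 0 < r -> 0 < s <= t ->
  (rsums t r n - rsums t s n <= / INR r)%R.
Proof.
move=> r0 /andP [s0 st]; have hr := Rinv_0_lt_compat _ (INR_pos r0).
case: n => [|n]; first by rewrite /rsums /=; lra.
rewrite {1}/rsums -add1n rsum_add add1n /= mul0n addn0.
have hs : (0 < / INR (s + n * t))%R by apply/Rinv_0_lt_compat/INR_pos; rewrite addn_gt0 s0.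
suff : (rsum (fun j => / INR (r + (1 + j) * t)) n <= rsums t s n)%R.
  by rewrite /rsums /=; lra.
apply: rsum_le => j _; apply: INR_inv_leq; first by rewrite addn_gt0 s0.
by nia.
Qed.

Lemma rsums_diff_term t r s j : 0 < r -> r <= s ->
  (0 <= / INR (r + j * t) - / INR (s + j * t))%R.
Proof.
move=> r0 rs; have := @INR_inv_leq (r + j * t) (s + j * t); rewrite addn_gt0 r0.
by rewrite leq_add2r rs => /(_ isT isT); lra.
Qed.

Lemma rsum_ge2 (a : nat -> R) u v n : (forall j, (0 <= a j)%R) -> u != v ->
  u < n -> v < n -> (a u + a v <= rsum a n)%R.
Proof.
move=> a0; wlog uv : u v / u < v.
  move=> W; case: (ltngtP u v) => // uv _ un vn; first by apply: W => //; rewrite ltn_eqF.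
  by rewrite Rplus_comm; apply: W => //; rewrite ltn_eqF.
move=> _ _ vn.
have h1 := rsum_leq a0 vn; have h2 := rsum_leq a0 uv.
have h0 := rsum_leq a0 (leq0n u); rewrite /= in h0 h1 h2; lra.
Qed.

(** The indices [u + k * j] meet each block of length [k] once, and miss [v] in the first block. *)
Lemma rsum_subseq (a : nat -> R) k u v J : (forall j, (0 <= a j)%R) ->
  u < k -> v < k -> u != v ->
  (rsum (fun j => a (u + k * j)%N) J.+1 + a v <= rsum a (k * J.+1))%R.
Proof.
move=> a0 uk vk uv; elim: J => [|J IH].
  by rewrite /= muln0 addn0 muln1; have := rsum_ge2 a0 uv uk vk; lra.
rewrite [in X in (_ <= X)%R]mulnS addnC rsum_add.
have h : (a (k * J.+1 + u)%N <= rsum (fun j => a (k * J.+1 + j)%N) k)%R.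
  have b0 j : (0 <= a (k * J.+1 + j)%N)%R by exact: a0.
  have h1 := rsum_leq b0 uk; have h0 := rsum_leq b0 (leq0n u); rewrite /= in h0 h1; lra.
by move: h; rewrite addnC; move: IH; rewrite /=; lra.
Qed.

Lemma succ_part1 k t r : 2 <= k -> coprime k t -> 1 <= r -> r <= t - k ->
  succ_kt k t r (r + k).
Proof.
move=> k2 kt r1 rtk; have rkt : r + k <= t by lia.
have k0 : 0 < k by lia. have t0 : 0 < t by lia. have kR := INR_pos k0.
have [r' /andP [r'0 r't] rr'] := residue_preimage r kt t0.
(* Needed for [r'.+1] to be a representative between 1 and [t]. *)
have r'lt : r' < t.
  rewrite ltn_neqAle r't andbT; apply/eqP => e; move: rr'.
  by rewrite e modnMl modn_small; lia.
have krr' : r <= k * r'.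
  by rewrite -(@modn_small r t) ?leq_mod -?rr' ?leq_mod //; lia.
have /dvdnP [u eu] : t %| k * r' - r by rewrite -eqn_mod_dvd // rr'.
have {}eu : k * r' = r + u * t by lia.
have uk : u < k by nia.
pose v := if u is 0 then 1 else 0.
have vk : v < k by rewrite /v; case: (u); lia.
have uv : u != v by rewrite /v; case: (u).
pose a j := (/ INR (r + j * t) - / INR (r + k + j * t))%R.
have a0 j : (0 <= a j)%R by apply: rsums_diff_term => //; rewrite leq_addr.
have av : (0 < a v)%R.
  by have := @INR_inv_lt (r + v * t) (r + k + v * t); rewrite /a => /(_ _ _) H;
    have := H ltac:(lia) ltac:(lia); lra.
apply: (@succ_of_gap k t r (r + k) r' r'.+1 (INR k * a v)%R) => //; try lia.
- by rewrite mulnS addnC -modnDml rr' modnDml.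
- by apply: Rmult_lt_0_compat.
move=> J0; exists J0.+1 => //.
rewrite !rsums_minus -/a.
rewrite [X in (_ <= _ - X)%R](_ : _ = INR k * rsum (fun j => a (u + k * j)%N) J0.+1)%R; last first.
  rewrite -rsum_mull; apply: eq_rsum => j _; rewrite /a.
  have e1 : r + (u + k * j) * t = k * (r' + j * t) by nia.
  have e2 : r + k + (u + k * j) * t = k * (r'.+1 + j * t) by nia.
  rewrite e1 e2 !INR_muln.
  have h1 : (0 < INR (r' + j * t))%R by apply: INR_pos; rewrite addn_gt0 r'0.
  have h2 : (0 < INR (r'.+1 + j * t))%R by apply: INR_pos.
  by field; lra.
have := rsum_subseq J0 a0 uk vk uv => h.
by have := Rmult_le_compat_l _ _ _ (Rlt_le _ _ kR) h; lra.
Qed.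

(** The subtracted difference is at most [1 / r' <= 1]. The term [j = 0] alone yields [k * (1 / r -
    1 / s) >= k / (r * (r + 1)) >= 1], and the term [j = 1] is the margin. *)
Lemma succ_part2 k t r y s : 2 <= k -> coprime k t -> 1 <= r -> r <= y -> r < s ->
  s <= t -> y * y.+1 <= k -> succ_kt k t r s.
Proof.
move=> k2 kt r1 ry rs st yk.
have k0 : 0 < k by lia. have t0 : 0 < t by lia. have kR := INR_pos k0.
have [r' r't rr'] := residue_preimage r kt t0.
have [s' s't ss'] := residue_preimage s kt t0.
pose a j := (/ INR (r + j * t) - / INR (s + j * t))%R.
have a0 j : (0 <= a j)%R by apply: rsums_diff_term => //; apply: ltnW.
have a1 : (0 < a 1%N)%R.
  by have := @INR_inv_lt (r + 1 * t) (s + 1 * t); rewrite /a => H;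
    have := H ltac:(lia) ltac:(lia); lra.
apply: (@succ_of_gap k t r s r' s' (INR k * a 1%N)%R) => //; try lia.
  by apply: Rmult_lt_0_compat.
move=> J0; exists J0.+1 => //.
have [r'0 _] := andP r't.
have ub := @rsums_diff_ub t r' s' J0.+1 r'0 s't.
have ub1 := @INR_inv_leq 1 r' isT r'0.
have lb := @rsum_ge2 a 0 1 (k * J0.+1) a0 isT _ _.
have {}lb := lb ltac:(lia) ltac:(nia).
rewrite (rsums_minus t r s) -/a.
have ka0 : (1 <= INR k * a 0%N)%R.
  rewrite /a !mul0n !addn0.
  have h1 : (/ INR s <= / INR r.+1)%R by apply: INR_inv_leq.
  have h2 := INR_pos r1.
  have h3 : (INR r * INR r.+1 <= INR k)%R.
    by rewrite -INR_muln; apply: INR_leq; apply: leq_trans yk; apply: leq_mul.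
  have h4 : (/ INR r - / INR r.+1 = / (INR r * INR r.+1))%R.
    by rewrite S_INR; field; lra.
  have h5 : (0 < INR r * INR r.+1)%R by rewrite -INR_muln; apply: INR_pos; rewrite muln_gt0 r1.
  have h6 : (1 <= INR k * / (INR r * INR r.+1))%R.
    rewrite -(Rinv_r (INR r * INR r.+1)); last lra.
    by apply: Rmult_le_compat_r => //; apply/Rlt_le/Rinv_0_lt_compat.
  apply: Rle_trans h6 _; apply: Rmult_le_compat_l; lra.
have := Rmult_le_compat_l _ _ _ (Rlt_le _ _ kR) lb.
by move: ub ub1; rewrite /= Rinv_1; lra.
Qed.

(** * Comparisons through [zeta(2)] *)

Lemma INR_ge2 t : 2 <= t -> (2 <= INR t)%R.
Proof. by move=> h; have := INR_leq h; rewrite /=; lra. Qed.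

(** Pairing [1 / (1 + j * t)] with [1 / (j * t)] for [j >= 1] leaves the initial 1, a vanishing
    boundary term and a convergent series. *)
Lemma rsums_1_t t J : 0 < t ->
  (rsums t 1 J.+1 - rsums t t J.+1 = 1 - / (INR J.+1 * INR t) -
   rsum (fun j => / (INR j.+1 * INR t * (INR j.+1 * INR t + 1))) J)%R.
Proof.
move=> t0; have tR := INR_pos t0.
have S r n : rsums t r n.+1 = (rsums t r n + / (INR r + INR n * INR t))%R.
  by rewrite /rsums [LHS]/= INR_addn INR_muln.
elim: J => [|J IH]; first by rewrite !S /rsums /=; field; lra.
rewrite S (S t) rsumS (S_INR J.+1) (_ : INR 1 = 1%R) //.
have h := INR_pos (ltn0Sn J).
have h2 : (0 < INR J.+1 * INR t)%R by apply: Rmult_lt_0_compat.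
have e : (/ (1 + INR J.+1 * INR t) = / (INR J.+1 * INR t) -
   / (INR J.+1 * INR t * (INR J.+1 * INR t + 1)))%R by field; lra.
have e2 : (INR t + INR J.+1 * INR t = (INR J.+1 + 1) * INR t)%R by ring.
rewrite e e2; lra.
Qed.

Lemma rsums_pred_t t n : 2 <= t ->
  (rsums t (t - 1) n - rsums t t n)%R =
  rsum (fun j => / ((INR j.+1 * INR t - 1) * (INR j.+1 * INR t)))%R n.
Proof.
move=> t2; have tR := INR_ge2 t2; rewrite rsums_minus; apply: eq_rsum => j _.
have jR := pos_INR j.
rewrite !INR_addn !INR_muln minus_INR; last by apply/leP; lia.
rewrite (_ : INR 1 = 1%R) // S_INR.
have h : (0 <= INR j * INR t)%R by apply: Rmult_le_pos; lra.
by field; nra.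
Qed.

Lemma rsums_diff_1_t t r s n : 0 < r <= t -> 0 < s <= t ->
  (rsums t r n - rsums t s n <= rsums t 1 n - rsums t t n)%R.
Proof.
move=> /andP [r0 rt] /andP [s0 st]; rewrite !rsums_minus; apply: rsum_le => j _.
have := @INR_inv_leq (1 + j * t) (r + j * t); have := @INR_inv_leq (s + j * t) (t + j * t).
rewrite !leq_add2r st r0 addn_gt0 s0 => /(_ isT isT) h1 /(_ isT isT) h2; lra.
Qed.

(** By convexity of the reciprocal, the gap is smallest for the last two neighbours. *)
Lemma rsums_diff_pred_t t r s n : 0 < r -> r < s -> s <= t ->
  (rsums t (t - 1) n - rsums t t n <= rsums t r n - rsums t s n)%R.
Proof.
move=> r0 rs st; rewrite !rsums_minus; apply: rsum_le => j _.
have tR := INR_ge2 (leq_ltn_trans r0 (leq_trans rs st)).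
have h1 : (/ INR (r.+1 + j * t) >= / INR (s + j * t))%R.
  by apply/Rle_ge/INR_inv_leq; lia.
suff : (/ INR (t - 1 + j * t) - / INR (t + j * t) <=
        / INR (r + j * t) - / INR (r.+1 + j * t))%R by lra.
have h a : 0 < a -> (/ INR a - / INR a.+1 = / (INR a * INR a.+1))%R.
  by move=> a0; have a1 := INR_pos a0; rewrite S_INR; field; lra.
have et : t + j * t = (t - 1 + j * t).+1 by lia.
rewrite et addSn !h; try lia.
rewrite -!INR_muln; apply: INR_inv_leq; first by rewrite muln_gt0; lia.
by apply: leq_mul; lia.
Qed.

(** For [x >= 2], [1 / x^3 <= 1 / ((x - 1) * x * (x + 1))], which telescopes to a total of [1 / 4];
    the induction carries the remaining tail. *)
Lemma rsum_inv_cube n : (rsum (fun j => / INR j.+1 ^ 3) n <= 5 / 4)%R.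
Proof.
have h m : (rsum (fun j => / INR j.+1 ^ 3) m.+1 <=
            5 / 4 - / (2 * (INR m + 1) * (INR m + 2)))%R.
  elim: m => [|m IH]; first by rewrite /=; lra.
  rewrite rsumS; apply: Rle_trans (Rplus_le_compat_r _ _ _ IH) _.
  rewrite !S_INR; have := pos_INR m; move: (INR m) => x x0.
  have e : (/ (2 * (x + 1) * (x + 2)) - / (2 * (x + 1 + 1) * (x + 1 + 2)) =
            / ((x + 1) * (x + 2) * (x + 3)))%R by field; lra.
  have : (/ (x + 1 + 1) ^ 3 <= / ((x + 1) * (x + 2) * (x + 3)))%R.
    by apply: Rinv_le_contravar; [apply: Rmult_lt_0_compat|]; nra.
  lra.
case: n => [|n]; first by rewrite /=; lra.
apply: Rle_trans (h n) _; have := pos_INR n => n0.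
have : (0 < / (2 * (INR n + 1) * (INR n + 2)))%R by apply: Rinv_0_lt_compat; nra.
lra.
Qed.

(** The first term is [1 / 4]; from [x = 3] on, [1 / x^2 <= 1 / ((x - 1/2) * (x + 1/2))] telescopes
    to [2 / 5]. *)
Lemma rsum_inv_square2 n : (rsum (fun j => / INR j.+2 ^ 2) n <= 13 / 20)%R.
Proof.
have h m : (rsum (fun j => / INR j.+2 ^ 2) m.+1 <= 13 / 20 - / (INR m + 5 / 2))%R.
  elim: m => [|m IH]; first by rewrite /=; lra.
  rewrite rsumS; apply: Rle_trans (Rplus_le_compat_r _ _ _ IH) _.
  rewrite !S_INR; have := pos_INR m; move: (INR m) => x x0.
  have e : (/ (x + 5 / 2) - / (x + 1 + 5 / 2) = / ((x + 5 / 2) * (x + 7 / 2)))%R.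
    by field; lra.
  have : (/ (x + 1 + 1 + 1) ^ 2 <= / ((x + 5 / 2) * (x + 7 / 2)))%R.
    by apply: Rinv_le_contravar; nra.
  lra.
case: n => [|n]; first by rewrite /=; lra.
apply: Rle_trans (h n) _; have := pos_INR n => n0.
have : (0 < / (INR n + 5 / 2))%R by apply: Rinv_0_lt_compat; nra.
lra.
Qed.

(** The worst case sets the smallest first difference, that of [t - 1] and [t], against the largest
    second one, that of [1] and [t]. The hypothesis on [k] makes [k * zeta(2) / t^2] at least
    [1 - 1 / t^2]; lower-order terms decide, with margin [eps]. *)
Lemma succ_part3 k t r s : 2 <= k -> 2 <= t -> coprime k t ->
  (6 * (INR t * INR t - 1) / (PI * PI) <= INR k)%R ->
  1 <= r -> r < s -> s <= t -> succ_kt k t r s.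
Proof.
move=> k2 t2 kt hk r1 rs st.
have k0 : 0 < k by lia. have t0 : 0 < t by lia. have kR := INR_ge2 k2.
have tR := INR_ge2 t2.
have [r' r't rr'] := residue_preimage r kt t0.
have [s' s't ss'] := residue_preimage s kt t0.
set T := INR t in tR hk *; set K := INR k in kR hk *.
have p := PI_RGT_0.
have hk' : (T * T - 1 <= K * (PI ^ 2 / 6))%R.
  have := Rmult_le_compat_r (PI * PI / 6) _ _ _ hk => /(_ _) H.
  rewrite (_ : (6 * (T * T - 1) / (PI * PI) * (PI * PI / 6) = T * T - 1)%R) in H; last by field; lra.
  have : (0 <= PI * PI / 6)%R by nra.
  by move=> /H; rewrite /=; lra.
(* Truncating [zeta(2)] may use up half of the correction [1 / (T - 1)]; the other half, times
   [K >= 2], remains. *)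
have e0 : (0 < / (2 * (T - 1)))%R by apply: Rinv_0_lt_compat; lra.
have [N hN] := zeta2_ge e0.
pose eps := (/ (T * T * (T - 1)) - / (T * T * (T + 1)))%R.
have TT : (0 < T * T)%R by nra.
have eps0 : (0 < eps)%R.
  rewrite /eps; suff : (/ (T * T * (T + 1)) < / (T * T * (T - 1)))%R by lra.
  apply: Rinv_lt_contravar; last by apply: Rmult_lt_compat_l; lra.
  by apply: Rmult_lt_0_compat; apply: Rmult_lt_0_compat; lra.
apply: (@succ_of_gap k t r s r' s' eps) => //; try lia.
move=> J0; exists (N + J0).+2; first by lia.
set J := (N + J0).+2; rewrite -/K.
have lb := rsums_diff_pred_t (k * J) r1 rs st.
have ub := rsums_diff_1_t J r't s't.
rewrite (rsums_1_t _ t0) -/T in ub.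
rewrite (rsums_pred_t _ t2) -/T in lb.
have ub2 : (/ (T * (T + 1)) <=
    rsum (fun j => / (INR j.+1 * T * (INR j.+1 * T + 1))) (N + J0).+1)%R.
  have pos j : (0 <= / (INR j.+1 * T * (INR j.+1 * T + 1)))%R.
    by apply/Rlt_le/Rinv_0_lt_compat; have := INR_pos (ltn0Sn j); nra.
  by have := rsum_leq pos (ltn0Sn (N + J0)); rewrite /= Rplus_0_l Rmult_1_l.
have ub3 : (0 < / (INR J * T))%R.
  by apply: Rinv_0_lt_compat; have := INR_pos (ltn0Sn (N + J0).+1); rewrite -/J; nra.
have lb2 : (/ (T * T) * zeta2 (k * J) + / (T * T * (T - 1)) <=
  rsum (fun j => / ((INR j.+1 * T - 1) * (INR j.+1 * T))) (k * J))%R.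
  rewrite /zeta2 -rsum_mull.
  pose b j := (/ ((INR j.+1 * T - 1) * (INR j.+1 * T)) - / (T * T) * / INR j.+1 ^ 2)%R.
  have bE j : (b j = / ((INR j.+1 * T - 1) * (INR j.+1 * T) * (INR j.+1 * T)))%R.
    have h : (1 <= INR j.+1)%R by rewrite S_INR; have := pos_INR j; lra.
    have h2 : (1 < INR j.+1 * T)%R by nra.
    by rewrite /b; field; lra.
  have b0 j : (0 <= b j)%R.
    rewrite bE; apply/Rlt_le/Rinv_0_lt_compat.
    have h : (1 <= INR j.+1)%R by rewrite S_INR; have := pos_INR j; lra.
    have h2 : (1 < INR j.+1 * T)%R by nra.
    by apply: Rmult_lt_0_compat; nra.
  have kJ : 0 < k * J by rewrite muln_gt0 k0.
  have := rsum_leq b0 kJ; rewrite [rsum b 1]/= bE Rplus_0_l /b rsum_minus.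
  rewrite (_ : INR 1 = 1%R) // !Rmult_1_l.
  by rewrite (_ : ((T - 1) * T * T = T * T * (T - 1))%R); [lra|ring].
have z := hN (k * J) (_ : _ <= _).
have {}z := z ltac:(nia).
rewrite -/J in ub.
set Z := zeta2 _ in z lb2.
have m1 : (/ (T * T) * (PI ^ 2 / 6 - / (2 * (T - 1))) <= / (T * T) * Z)%R.
  by apply: Rmult_le_compat_l => //; apply/Rlt_le/Rinv_0_lt_compat.
have m2 : (K * (/ (T * T) * (PI ^ 2 / 6 - / (2 * (T - 1))) + / (T * T * (T - 1))) <=
           K * (rsums t r (k * J) - rsums t s (k * J)))%R.
  by apply: Rmult_le_compat_l; lra.
have m3 : (K * (/ (T * T) * (PI ^ 2 / 6 - / (2 * (T - 1))) + / (T * T * (T - 1))) =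
   K * (PI ^ 2 / 6) * / (T * T) + K * / (2 * (T * T * (T - 1))))%R by field; lra.
have m4 : ((T * T - 1) * / (T * T) <= K * (PI ^ 2 / 6) * / (T * T))%R.
  by apply: Rmult_le_compat_r => //; apply/Rlt_le/Rinv_0_lt_compat.
have m5 : (2 * / (2 * (T * T * (T - 1))) <= K * / (2 * (T * T * (T - 1))))%R.
  by apply: Rmult_le_compat_r => //; apply/Rlt_le/Rinv_0_lt_compat; nra.
have m6 : ((T * T - 1) * / (T * T) + 2 * / (2 * (T * T * (T - 1))) - (1 - / (T * (T + 1))) = eps)%R.
  by rewrite /eps; field; lra.
lra.
Qed.

(** Since [k = -1 (mod t)], the preimages of [t] and [t - 1] are [t] and [1]. So [1] against [t] now
    counts in favour, and [k] times [t - 1] against [t] counts as the loss. *)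
Lemma succ_part4 k t m : 2 <= k -> 2 <= t -> coprime k t -> 1 <= m -> k = m * t - 1 ->
  (INR k <= / (PI * PI / 6 + 5 / (2 * INR t)) * (INR t * INR t - 1))%R ->
  succ_kt k t t (t - 1).
Proof.
move=> k2 t2 kt m1 kmt hk.
have k0 : 0 < k by lia. have t0 : 0 < t by lia. have kR := INR_ge2 k2.
have tR := INR_ge2 t2.
have kt1 : (INR t - 1 <= INR k)%R.
  have : (INR t <= INR k.+1)%R by apply: INR_leq; nia.
  by rewrite S_INR; lra.
have p : (3 < PI)%R by have := PI2_3_2; lra.
have hk' : (INR k * (PI ^ 2 / 6 + 5 / (2 * INR t)) <= INR t * INR t - 1)%R.
  have i0 : (0 < / INR t)%R by apply: Rinv_0_lt_compat; lra.
  have q0 : (0 < PI * PI / 6 + 5 / (2 * INR t))%R.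
    by rewrite /Rdiv Rinv_mult; nra.
  have := Rmult_le_compat_r _ _ _ (Rlt_le _ _ q0) hk.
  rewrite (Rmult_comm (/ _)) Rmult_assoc Rinv_l; last lra.
  by rewrite /=; lra.
have t3 : 3 <= t.
  rewrite ltn_neqAle t2 andbT; apply/eqP => e2; move: hk' kR; rewrite -e2 /= => h1 h2.
  by nra.
have t3R : (3 <= INR t)%R by have := INR_leq t3; rewrite /=; lra.
set T := INR t in tR t3R hk' kt1 *; set K := INR k in kR hk' kt1 *.
have TT : (0 < T * T)%R by nra.
(* A lower bound for the gap, up to the boundary term [/ (INR J * T)]: [13 / 20] comes from
   [rsum_inv_square2], [5 / 4] from [rsum_inv_cube]. *)
pose M := (1 - / (T * (T + 1)) - / (T * T) * (13 / 20)
           - K * (/ (T * T) * (PI ^ 2 / 6 + / (T - 1) * (5 / 4))))%R.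
have M0 : (0 < M)%R.
  apply: (Rmult_lt_reg_r (T * T)) => //; rewrite Rmult_0_l.
  have -> : (M * (T * T) = T * T - 1 - K * (PI ^ 2 / 6 + 5 / (2 * T))
      + K * (5 * (T - 2) / (4 * T * (T - 1))) + (/ (T + 1) - 13 / 20))%R.
    by rewrite /M; field; lra.
  (* [K >= T - 1] reduces positivity to [6 * T^2 - 9 * T - 25 > 0], which holds from [T = 3] on but
     fails at [T = 2]. *)
  have a1 : ((T - 1) * (5 * (T - 2) / (4 * T * (T - 1))) <=
             K * (5 * (T - 2) / (4 * T * (T - 1))))%R.
    apply: Rmult_le_compat_r => //; apply: Rmult_le_pos; first lra.
    by apply/Rlt_le/Rinv_0_lt_compat; nra.
  have a2 : ((T - 1) * (5 * (T - 2) / (4 * T * (T - 1))) + (/ (T + 1) - 13 / 20) =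
     (6 * T ^ 2 - 9 * T - 25) / (10 * T * (T + 1)))%R by field; lra.
  have a3 : (0 < (6 * T ^ 2 - 9 * T - 25) / (10 * T * (T + 1)))%R.
    by apply: Rdiv_lt_0_compat; nra.
  lra.
have [N hN] := INR_bounded (2 / M).
apply: (@succ_of_gap k t t (t - 1) t 1 (M / 2)%R) => //; try lia.
- by rewrite modnMl modnn.
- rewrite muln1 kmt (_ : m * t - 1 = (m.-1) * t + (t - 1)); first by rewrite modnMDl.
  by nia.
- lra.
move=> J0; exists (N + J0).+1; first by lia.
set J := (N + J0).+1; rewrite -/K.
have eq1 := rsums_1_t (N + J0) t0; rewrite -/J -/T in eq1.
have eq2 := rsums_pred_t (k * J) t2; rewrite -/T in eq2.
have JR : (0 < INR J)%R by exact: INR_pos.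
have j1 : (/ (INR J * T) <= M / 2)%R.
  have NJ : (2 / M <= INR J)%R by apply: Rle_trans hN (INR_leq _); rewrite /J; lia.
  have := Rmult_le_compat_r _ _ _ (Rlt_le _ _ M0) NJ.
  rewrite (_ : (2 / M * M = 2)%R); last by field; lra.
  move=> h; have h2 : (/ (INR J * T) <= / INR J)%R by apply: Rinv_le_contravar; nra.
  apply: Rle_trans h2 _; apply: (Rmult_le_reg_l (INR J)) => //.
  by rewrite Rinv_r; lra.
have b1 : (rsum (fun j => / (INR j.+1 * T * (INR j.+1 * T + 1))) (N + J0) <=
           / (T * (T + 1)) + / (T * T) * (13 / 20))%R.
  apply: (Rle_trans _ (rsum (fun j => / (INR j.+1 * T * (INR j.+1 * T + 1))) (1 + (N + J0)))%R).
    apply: rsum_leq; last by lia.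
    move=> j; apply/Rlt_le/Rinv_0_lt_compat.
    have xT : (0 < INR j.+1 * T)%R by apply: Rmult_lt_0_compat; [apply: INR_pos|lra].
    by apply: Rmult_lt_0_compat; lra.
  rewrite rsum_add rsumS (_ : INR 1 = 1%R) // Rmult_1_l [rsum _ 0]/= Rplus_0_l.
  apply: Rplus_le_compat_l.
  apply: Rle_trans (Rmult_le_compat_l (/ (T * T)) _ _ _ (rsum_inv_square2 (N + J0))); last first.
    exact/Rlt_le/Rinv_0_lt_compat.
  rewrite -rsum_mull; apply: rsum_le => j _; rewrite add1n.
  have h := INR_pos (ltn0Sn j.+1); rewrite -Rinv_mult; apply: Rinv_le_contravar.
    by apply: Rmult_lt_0_compat => //; apply: pow_lt.
  have h2 : (0 < INR j.+2 * T)%R by apply: Rmult_lt_0_compat; lra.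
  rewrite (_ : (T * T * INR j.+2 ^ 2 = INR j.+2 * T * (INR j.+2 * T))%R); last by ring.
  by apply: Rmult_le_compat_l; lra.
have b2 : (rsum (fun j => / ((INR j.+1 * T - 1) * (INR j.+1 * T))) (k * J) <=
           / (T * T) * (PI ^ 2 / 6 + / (T - 1) * (5 / 4)))%R.
  have i1 : (0 < / (T - 1))%R by apply: Rinv_0_lt_compat; lra.
  have z := zeta2_le (k * J).
  have c := Rmult_le_compat_l _ _ _ (Rlt_le _ _ i1) (rsum_inv_cube (k * J)).
  apply: Rle_trans (Rmult_le_compat_l (/ (T * T)) _ _ _ (Rplus_le_compat _ _ _ _ z c)); last first.
    exact/Rlt_le/Rinv_0_lt_compat.
  rewrite /zeta2 -rsum_mull -rsum_plus -rsum_mull; apply: rsum_le => j _.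
  have h : (1 <= INR j.+1)%R by rewrite S_INR; have := pos_INR j; lra.
  move: (INR j.+1) h => x h.
  have -> : (/ (T * T) * (/ x ^ 2 + / (T - 1) * / x ^ 3) =
     / ((x * T) ^ 2) + / ((x * T) ^ 2 * (x * (T - 1))))%R by field; lra.
  have xT : (1 < x * T)%R by nra.
  have -> : (/ ((x * T - 1) * (x * T)) = / ((x * T) ^ 2) + / ((x * T) ^ 2 * (x * T - 1)))%R.
    by field; lra.
  apply: Rplus_le_compat_l; apply: Rinv_le_contravar.
    by apply: Rmult_lt_0_compat; nra.
  by apply: Rmult_le_compat_l; nra.
have b3 := Rmult_le_compat_l K _ _ ltac:(lra) b2.
rewrite -eq2 in b3.
move: b1 b3 j1 eq1; rewrite /M.
move: (rsum _ _) (rsums _ _ _) (rsums _ _ _) (rsums _ _ _) (rsums _ _ _).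
move=> *; lra.
Qed.

(** The full series is [ln 2]. Two exact terms, [1/2 + 1/12], and a telescoping tail of [1/8] give a
    rational bound below the [3 / 4] needed for [succ_small], with [1 / 24] to spare. *)
Lemma rsum_inv_pairs n :
  (rsum (fun j => / (INR (2 * j + 1) * INR (2 * j + 2))) n <= 17 / 24)%R.
Proof.
pose f j := (/ (INR (2 * j + 1) * INR (2 * j + 2)))%R.
have f0 j : (0 < f j)%R.
  by apply: Rinv_0_lt_compat; apply: Rmult_lt_0_compat; apply: INR_pos; lia.
have h m : (rsum f m.+2 <= 17 / 24 - / (4 * (INR m + 2)))%R.
  elim: m => [|m IH]; first by rewrite /f /=; lra.
  rewrite rsumS; apply: Rle_trans (Rplus_le_compat_r _ _ _ IH) _.
  rewrite /f !INR_addn !INR_muln !S_INR (_ : INR 0 = 0%R) //.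
  have := pos_INR m; move: (INR m) => x x0.
  have e : (/ (4 * (x + 2)) - / (4 * (x + 1 + 2)) = / (4 * (x + 2) * (x + 3)))%R.
    by field; lra.
  have : (/ (((0 + 1 + 1) * (x + 1 + 1) + (0 + 1)) *
             ((0 + 1 + 1) * (x + 1 + 1) + (0 + 1 + 1))) <= / (4 * (x + 2) * (x + 3)))%R.
    by apply: Rinv_le_contravar; nra.
  lra.
have n2 : n <= n.+2 by lia.
have := rsum_leq (fun j => Rlt_le _ _ (f0 j)) n2; have := h n.
have : (0 < / (4 * (INR n + 2)))%R.
  by apply: Rinv_0_lt_compat; have := pos_INR n; lra.
by rewrite -/f; lra.
Qed.

(* For [k < t / 2] the part [k] has lost its main contribution [1 / k], and falls below
   every [s] with [k < s < 2 * k]. *)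
Lemma succ_small k t i : 2 <= k -> coprime k t -> 2 * k < t -> 1 <= i -> i < k ->
  succ_kt k t (i + k) k.
Proof.
move=> k2 kt kt2 i1 ik.
have k0 : 0 < k by lia. have t0 : 0 < t by lia. have kR := INR_pos k0.
have [r' /andP [r'0 r't] rr'] := residue_preimage (i + k) kt t0.
(* As [k < i + k < 2 * k < t], none of [k], [2 * k], [3 * k] is [i + k] modulo [t]; if [3 * k >= t],
   then [3 * k - t < k]. *)
have r'4 : 4 <= r'.
  move: rr'; rewrite [RHS]modn_small; last by lia.
  case: r' r'0 r't => [//|[|[|[|r']]]] _ _ // e.
  - by move: e; rewrite muln1 modn_small; lia.
  - by move: e; rewrite modn_small; lia.
  - case: (ltnP (k * 3) t) => kt3; first by move: e; rewrite modn_small //; lia.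
    move: e; rewrite -[k * 3](subnK kt3) modnDr modn_small; lia.
apply: (@succ_of_gap k t (i + k) k r' 1 (1 / 24)%R) => //; try lia.
- by rewrite muln1.
- lra.
move=> J0; exists J0.+1 => //; set J := J0.+1.
have d0 j : (0 <= / INR (1 + j * t) - / INR (r' + j * t))%R by apply: rsums_diff_term.
have lb : (3 / 4 <= rsums t 1 J - rsums t r' J)%R.
  have := rsum_leq d0 (isT : 0 < J); rewrite rsums_minus.
  have := @INR_inv_leq 4 r' isT r'4.
  rewrite rsumS [rsum _ 0]/= Rplus_0_l !mul0n !addn0 (_ : INR 1 = 1%R) //.
  rewrite (_ : INR 4 = 4%R); last by rewrite /=; lra.
  lra.
have ub : (INR k * (rsums t k (k * J) - rsums t (i + k) (k * J)) <= 17 / 24)%R.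
  apply: Rle_trans (rsum_inv_pairs (k * J)); rewrite rsums_minus -rsum_mull.
  apply: rsum_le => j _.
  have h1 : 0 < k + j * t by lia. have h2 : 0 < i + k + j * t by lia.
  have H1 := INR_pos h1; have H2 := INR_pos h2.
  have h3 : 0 < 2 * j + 1 by lia. have h4 : 0 < 2 * j + 2 by lia.
  have H3 := INR_pos h3; have H4 := INR_pos h4.
  have -> : (INR k * (/ INR (k + j * t) - / INR (i + k + j * t)) =
     INR k * INR i / (INR (k + j * t) * INR (i + k + j * t)))%R.
    rewrite (_ : i + k + j * t = i + (k + j * t)) in H2 *; last by lia.
    by rewrite INR_addn in H2 *; field; lra.
  apply: (Rmult_le_reg_r (INR (k + j * t) * INR (i + k + j * t))); first nra.
  rewrite /Rdiv Rmult_assoc Rinv_l; last nra.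
  apply: (Rmult_le_reg_l (INR (2 * j + 1) * INR (2 * j + 2))); first nra.
  rewrite [X in (_ <= X)%R](_ : _ = INR (k + j * t) * INR (i + k + j * t))%R; last first.
    by field; lra.
  rewrite Rmult_1_r -!INR_muln; apply: INR_leq.
  have g1 : (2 * j + 1) * k <= k + j * t by nia.
  have g2 : (2 * j + 2) * i <= i + k + j * t by nia.
  by have := leq_mul g1 g2; lia.
lra.
Qed.

Lemma succ_kt_asym k t r s : succ_kt k t r s -> ~ prec_kt k t r s.
Proof.
move=> [N hN] [M hM]; have := hN (maxn N M) (leq_maxl _ _).
by have := hM (maxn N M) (leq_maxr _ _); lia.
Qed.

(** * Distinct orderings *)

(* The multiplier [1] is not admissible; it is replaced by one so large that the ordering
   is the natural one. *)
Definition multiplier (t i : nat) : nat := if i == 1 then (t * t.+1).+1 else i.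

Lemma multiplier_admissible t i : 2 < t -> 0 < i -> coprime i t ->
  2 <= multiplier t i /\ coprime (multiplier t i) t.
Proof.
rewrite /multiplier => t2 i0 it; case: eqP => [_|/eqP i1]; last by split=> //; lia.
split; first by nia.
by rewrite (_ : (t * t.+1).+1 = t.+1 * t + 1) ?/coprime 1?gcdnC ?gcdnMDl ?gcdn1 //; lia.
Qed.

(** The pair [j], [i + j] separates the two orderings; when [i = 1], the large multiplier still
    ranks [j] first, by [succ_part2] with [y = t]. *)
Lemma multiplier_orderings t i j : 0 < i -> i < j -> 2 * j < t ->
  coprime i t -> coprime j t -> ~ same_ordering t (multiplier t i) (multiplier t j).
Proof.
move=> i0 ij jt cit cjt same.
have j1 : (j == 1) = false by apply/eqP; lia.
have small : succ_kt j t (i + j) j by apply: succ_small => //; lia.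
have [k2 ck] := multiplier_admissible (ltac:(lia) : 2 < t) i0 cit.
have big : succ_kt (multiplier t i) t j (i + j).
  move: k2 ck; rewrite /multiplier; case: eqP => [_|i1] k2 ck.
    by apply: (@succ_part2 _ t j t) => //; lia.
  by rewrite addnC; apply: succ_part1 => //; lia.
have [_ h] := same j (i + j) ltac:(lia) ltac:(lia).
by apply: (succ_kt_asym big); apply: h; rewrite /multiplier j1.
Qed.

(** The reflection [i -> t - i] pairs the units below [t / 2] with those above; [t / 2] itself is no
    unit when [t > 2]. *)
Lemma totient_half t : 2 < t ->
  totient t <= 2 * size [seq i <- index_iota 1 t | (2 * i < t) && coprime i t].
Proof.
move=> t2; rewrite totient_count_coprime -sum1_size big_filter.
rewrite big_ltn; last by lia.
rewrite {1}/coprime gcdn0 (_ : (t == 1) = false) ?add0n; last by apply/eqP; lia.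
rewrite [X in _ <= 2 * X]big_mkcond /= (bigID (fun i => 2 * i < t)) /= mul2n -addnn.
rewrite [X in X + _ <= _]big_mkcond /= [X in _ + X <= _]big_mkcond /= [X in _ + X <= _]big_nat_rev /=.
apply: leq_add; rewrite !big_nat; apply: leq_sum => i /andP [i1 it].
  by rewrite coprime_sym; case: (2 * i < t) => //=; case: coprime.
rewrite (_ : 1 + t - i.+1 = t - i); last by lia.
have -> : coprime t (t - i) = coprime i t.
  rewrite coprime_sym /coprime -{2 3}(subnK (ltnW it)) gcdnDl gcdnDr.
  by rewrite gcdnC.
case cit: (coprime i t); last by rewrite andbF; case: ifP.
case: ifP => //; rewrite -leqNgt andbT => h; case: ltnP => // h2.
have e : t = 2 * i by lia.
by move: cit; rewrite e /coprime gcdnMl; lia.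
Qed.

Theorem theorem1p6 (k t : nat) :
  2 <= k -> 2 <= t -> coprime k t ->
  (* (1) *)
  (forall r, 1 <= r -> r <= t - k -> succ_kt k t r (r + k)) /\
  (* (2) *)
  (forall r y s, 1 <= r -> r <= y -> y <= t -> r < s -> s <= t ->
     y * y.+1 <= k -> succ_kt k t r s) /\
  (* (2), special case y = 1 *)
  (forall s, 2 <= s -> s <= t -> succ_kt k t 1 s) /\
  (* (3) *)
  ((6 * (INR t * INR t - 1) / (PI * PI) <= INR k)%R ->
     forall r s, 1 <= r -> r < s -> s <= t -> succ_kt k t r s) /\
  (* (4) *)
  (forall m, 1 <= m -> k = m * t - 1 ->
     (INR k <= / (PI * PI / 6 + 5 / (2 * INR t)) * (INR t * INR t - 1))%R ->
     succ_kt k t t (t - 1)) /\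
  (* (5): O(t) >= phi(t)/2, i.e. there are at least phi(t)/2 admissible k'
     inducing pairwise distinct orderings *)
  (2 < t ->
     exists ks : seq nat,
       (forall k', k' \in ks -> 2 <= k' /\ coprime k' t) /\
       (forall i j, i < size ks -> j < size ks -> i <> j ->
          ~ same_ordering t (nth 0 ks i) (nth 0 ks j)) /\
       totient t <= 2 * size ks).
Proof.
move=> k2 t2 kt; split; first by move=> r; apply: succ_part1.
split; first by move=> r y s r1 ry yt rs st; apply: succ_part2 ry rs st.
split; first by move=> s s2 st; apply: (@succ_part2 k t 1 1 s).
split; first by move=> hk r s; apply: succ_part3.
split; first by move=> m m1 km hk; apply: succ_part4 m1 km hk.
move=> t3; pose is_ := [seq i <- index_iota 1 t | (2 * i < t) && coprime i t].
have isP i : i \in is_ -> [/\ 0 < i, 2 * i < t & coprime i t].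
  by rewrite mem_filter mem_index_iota => /andP [/andP [h1 h2] /andP [h3 _]].
have uniq_is : uniq is_ by rewrite filter_uniq // iota_uniq.
exists (map (multiplier t) is_); split; last split.
- by move=> _ /mapP [i /isP [i0 _ it] ->]; apply: multiplier_admissible.
- move=> a b; rewrite size_map => ha hb ab.
  rewrite !(nth_map 0) //.
  have [i0 i2 ci] := isP _ (mem_nth 0 ha); have [j0 j2 cj] := isP _ (mem_nth 0 hb).
  have : nth 0 is_ a != nth 0 is_ b by rewrite nth_uniq //; apply/eqP.
  rewrite neq_ltn => /orP [ij|ji]; first exact: multiplier_orderings.
  move=> same; apply: (multiplier_orderings j0 ji i2 cj ci) => r s hr hs.
  by split; apply same.
- by rewrite size_map; apply: totient_half.
Qed.
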